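(* Assume that for any $t\in\mathbb{R}$ we have $\lim_{n\to\infty}\big[\mathbb{P}(X_1^{(n)}\le t)-\mathbb{P}(\xi^{(n)}\le t)\big]=0$. Let $L:=\ln(1/q)$, $n_2:=np^2/q^2$, $i^*:=\ln(n_2)/(2L)$ (so that $q^{2i^*}=1/n_2$), $\alpha:=q^2/(1-q^2)$, write $\eta:=i-i^*$ with $i$ an integer, and define $$\Psi(\eta):=e^{-e^{-2L\eta}}\prod_{i=1}^\infty\Big[1-e^{-e^{-2L(\eta-i)}}\Big].$$ Then the asymptotic distribution $f(\eta)$ of $X_1^{(n)}$ is given as follows: as $n\to\infty$, $$\mathbb{P}\big(X_1^{(n)}=i^*+\eta\big)\sim f(\eta):=\sum_{v=0}^\infty\Psi(\eta-v+1)\,e^{-\alpha e^{-2L(\eta+1-v)}}\sum_{\substack{r_1<\cdots<r_v\\ r_j\ge 2-v}}\ \prod_{i=1}^v\frac{1-e^{-e^{-2L(\eta+r_i)}}}{e^{-e^{-2L(\eta+r_i)}}},$$ $$\mathbb{P}\big(X_1^{(n)}\le i^*+\eta\big)\sim F(\eta):=\sum_{i=0}^\infty f(\eta-i),$$ and the function $f(\eta)$ depends only on $p$.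
   Context: Let $0<p<1$, $q=1-p$. $Z_1,\ldots,Z_n$ are i.i.d. geometric random variables, $\mathbb{P}(Z_k=i)=P_i:=p\,q^{i-1}$ for $i\ge1$. $X_{i,i}^{(n)}$ is the indicator of the event that $Z_k=Z_{k+1}=i$ for some $1\le k\le n-1$, and $X_1^{(n)}:=\sum_{i\ge1}X_{i,i}^{(n)}$. Further, $\xi^{(n)}:=\sum_{i\ge1}\mathbf{1}[\xi_i^{(n)}\ge1]$, where $(\xi_i^{(n)})_{i\ge1}$ are independent and $\xi_i^{(n)}$ is Poisson distributed with parameter $nP_i^2$. The hypothesis on the distribution functions is a conjecture in the source. In $f$, the $r_j$ are integers, and for $v=0$ the inner sum (over the empty tuple, with empty product) equals $1$. *)

(* Defs.v *)
From mathcomp Require Export all_boot all_order all_algebra.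
From mathcomp Require Export all_classical all_reals all_analysis.
Export Order.TTheory GRing.Theory Num.Theory.
Export numFieldNormedType.Exports.

Set Implicit Arguments.
Unset Strict Implicit.
Unset Printing Implicit Defensive.

Local Open Scope classical_set_scope.
Local Open Scope ring_scope.

Section random_variables.
Context {d} {T : measurableType d} {R : realType} (P : probability T R).

Definition mutually_independent {d'} {T' : measurableType d'} {I : eqType}
    (X : I -> {RV P >-> T'}) : Prop :=
  forall (s : seq I) (A : I -> set T'), uniq s ->
    (forall i, measurable (A i)) ->
    P (\bigcap_(i in [set` s]) (X i @^-1` A i)) =
    (\prod_(i <- s) P (X i @^-1` A i))%E.

(* P_i; only meaningful for 1 <= i *)
Definition geometric_pmf (p : R) (i : nat) : R := p * (1 - p) ^+ i.-1.

(* Support {1, 2, ...}; these values have total mass 1, so P(X = 0) = 0. *)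
Definition is_geometric (p : R) (X : {RV P >-> nat}) : Prop :=
  forall i, (1 <= i)%N -> P [set w | X w = i] = (geometric_pmf p i)%:E.

(* [poisson_pmf rate] is the Poisson distribution only for 0 < rate. *)
Definition is_poisson (rate : R) (X : {RV P >-> nat}) : Prop :=
  forall k, P [set w | X w = k] = (poisson_pmf rate k)%:E.

(* [Z k] is Z_{k+1}: the consecutive pairs among Z_1, ..., Z_n are
   (Z k, Z k.+1) with k.+1 < n. *)
Definition Xii (Z : nat -> {RV P >-> nat}) (n i : nat) (w : T) : R :=
  \1_[set w | exists k, [/\ (k.+1 < n)%N, Z k w = i & Z k.+1 w = i]] w.

(* Extended-real valued, so that the infinite sum is always meaningful. *)
Definition X1 (Z : nat -> {RV P >-> nat}) (n : nat) (w : T) : \bar R :=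
  (\sum_(1 <= i <oo) (Xii Z n i w)%:E)%E.

(* [xi n i] is xi_{i+1}^(n). *)
Definition xi_total (xi : nat -> nat -> {RV P >-> nat}) (n : nat) (w : T) :
    \bar R :=
  (\sum_(0 <= i <oo) (\1_[set w | (1 <= xi n i w)%N] w : R)%:E)%E.

End random_variables.

Section asymptotic_law.
Context {R : realType} (p : R).
Let q : R := 1 - p.

Definition L : R := ln (1 / q).

Definition n2 (n : nat) : R := n%:R * p ^+ 2 / q ^+ 2.

Definition istar (n : nat) : R := ln (n2 n) / (2 * L).

Definition alpha : R := q ^+ 2 / (1 - q ^+ 2).

Definition ee (eta : R) : R := expR (- expR (- (2 * L * eta))).

Definition Psi (eta : R) : R :=
  ee eta * limn (fun m => \prod_(1 <= i < m.+1) (1 - ee (eta - i%:R))).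

(* The summands are nonnegative, so the sums are taken in [\bar R]; the indices
   r_1 < ... < r_v are the strictly sorted v-tuples of integers. *)
Definition f (eta : R) : \bar R :=
  (\sum_(0 <= v <oo)
     (Psi (eta - v%:R + 1)
        * expR (- (alpha * expR (- (2 * L * (eta + 1 - v%:R))))))%:E *
     \esum_(r in [set r : v.-tuple int |
                   sorted <%R r /\ forall j, (2 - v%:Z <= tnth r j)%R])
       (\prod_(j < v) ((1 - ee (eta + (tnth r j)%:~R))
                         / ee (eta + (tnth r j)%:~R))%R)%:E)%E.

Definition F (eta : R) : \bar R := (\sum_(0 <= i <oo) f (eta - i%:R))%E.

End asymptotic_law.

(* Main.v *)
Require Import Defs.
From mathcomp Require Import ring lra zify.

(* Only letters i within bounded distance of i^* matter. Let a_n be the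
   probability that Z_1, ..., Z_n contains no pair (i, i) with i in a finite set
   S, and put s = sum P_i^2, t = sum P_i^3 over S. Conditioning on the last
   letter gives a_(n+2) = (1 - s) a_(n+1) + O(s^2 + t), whence
   |a_n - e^(- n s)| <= s + n (2 s^2 + t), which is small when n P_i^2 is bounded
   and P_i -> 0. By inclusion-exclusion the indicators X_(i,i), for i in a window
   k - M, ..., k + M, are asymptotically independent with
   P(X_(i,i) = 0) ~ e^(- n P_i^2). Left of the window all of them are 1 and right
   of it all are 0, up to a probability that is geometrically small in M, so
   X_1 = k amounts to exactly M + 1 ones in the window.

   On the analytic side, decomposing that event along its first zero, at position
   k + 1 - v, yields the v-th summand of f: Psi accounts for the ones before the
   zero and the zero itself, and the elementary symmetric sum of the odds, times
   the probability that all later positions vanish, for the v ones after it. All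
   errors are geometric in M, uniformly for bounded eta, and f is bounded away
   from 0 there. *)

Set Implicit Arguments.
Unset Strict Implicit.
Unset Printing Implicit Defensive.

Local Open Scope classical_set_scope.
Local Open Scope ring_scope.

(** * The geometric bounds and the Poisson-binomial window *)

Lemma prod_1sub_ge {R : realFieldType} (I : Type) (s : seq I) (Pr : pred I)
    (a : I -> R) : (forall i, Pr i -> 0 <= a i <= 1) ->
  1 - \sum_(i <- s | Pr i) a i <= \prod_(i <- s | Pr i) (1 - a i).
Proof.
move=> a01; elim: s => [|i s IH]; first by rewrite !big_nil subr0.
rewrite !big_cons; case: ifP => // /a01 ai.
have P1 : 0 <= \prod_(i <- s | Pr i) (1 - a i) <= 1.
  apply/andP; split.
    by apply: prodr_ge0 => j /a01 aj; lra.
  by rewrite prodr_ile1// => j /a01 aj; lra.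
nra.
Qed.

Lemma sum_geometric_le {R : realFieldType} (c z : R) (a b : nat) :
  0 <= c -> 0 <= z < 1 ->
  \sum_(a <= j < b) c * z ^+ j <= c * z ^+ a / (1 - z).
Proof.
move=> c0 /andP[z0 z1]; have z1' : 0 < 1 - z by rewrite subr_gt0.
rewrite -big_distrr /= -mulrA ler_wpM2l//.
have [ab|ba] := leqP a b; last first.
  by rewrite big_geq ?(ltnW ba)// divr_ge0// ?exprn_ge0// ltW.
rewrite ler_pdivlMr// mulrC.
rewrite -{1}(subnKC ab); elim: (b - a)%N => [|n IH].
  by rewrite addn0 big_geq// mulr0 exprn_ge0.
have -> : (1 - z) * \sum_(a <= j < a + n.+1) z ^+ j = z ^+ a - z ^+ (a + n.+1).
  clear IH; elim: n.+1 => [|m IH]; first by rewrite addn0 big_geq// mulr0 subrr.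
  by rewrite addnS big_nat_recr ?leq_addr//= mulrDr IH exprS; ring.
by rewrite gerBl exprn_ge0.
Qed.

Section analysis.
Context {R : realType} (p : R).
Hypotheses (p_gt0 : 0 < p) (p_lt1 : p < 1).

(* Normalized so that [decay (i - istar p n)] is n * P_i^2. *)
Definition decay (x : R) : R := expR (- (2 * L p * x)).

Definition qq : R := (1 - p) ^+ 2.

Local Notation y := decay.
Local Notation Q := qq.

Lemma qq_gt0 : 0 < Q. Proof. by rewrite /qq exprn_gt0// subr_gt0. Qed.

Lemma qq_lt1 : Q < 1.
Proof. by rewrite /qq exprn_ilt1 //; [rewrite subr_ge0 ltW|rewrite ltrBlDr ltrDl]. Qed.

Lemma qq_bounds : 0 <= Q < 1. Proof. by rewrite ltW ?qq_gt0// qq_lt1. Qed.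

Lemma L_gt0 : 0 < L p.
Proof. by rewrite /L ln_gt0// div1r invf_gt1 ?subr_gt0// ltrBlDr ltrDl. Qed.

Lemma decay_gt0 x : 0 < y x. Proof. exact: expR_gt0. Qed.
Lemma decay_ge0 x : 0 <= y x. Proof. exact: expR_ge0. Qed.

Lemma decayD a b : y (a + b) = y a * y b.
Proof. by rewrite /decay -expRD; congr expR; ring. Qed.

Lemma decayN x : y (- x) = (y x)^-1.
Proof. by rewrite /decay -expRN; congr expR; ring. Qed.

Lemma decay0 : y 0 = 1. Proof. by rewrite /decay mulr0 oppr0 expR0. Qed.

Lemma decay1 : y 1 = Q.
Proof.
have q0 : 0 < 1 - p by rewrite subr_gt0.
rewrite /decay /L div1r lnV ?posrE// mulr1 mulrN opprK mulrC mulr_natr -lnXn//.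
by rewrite lnK// posrE exprn_gt0.
Qed.

Lemma decay_nat n : y n%:R = Q ^+ n.
Proof.
elim: n => [|n IH]; first by rewrite decay0 expr0.
by rewrite -natr1 decayD IH decay1 exprSr.
Qed.

Lemma decayDn x n : y (x + n%:R) = y x * Q ^+ n.
Proof. by rewrite decayD decay_nat. Qed.

Lemma decayS x : y (x + 1) = Q * y x.
Proof. by rewrite decayD decay1 mulrC. Qed.

Lemma decay_le a b : a <= b -> y b <= y a.
Proof.
move=> ab; rewrite /decay ler_expR lerN2 ler_wpM2l//.
by rewrite mulr_ge0 ?ler0n// ltW// L_gt0.
Qed.

Lemma ee_decay x : ee p x = expR (- y x). Proof. by []. Qed.

Lemma ee_gt0 x : 0 < ee p x. Proof. exact: expR_gt0. Qed.
Lemma ee_ge0 x : 0 <= ee p x. Proof. exact: expR_ge0. Qed.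
Lemma ee_le1 x : ee p x <= 1.
Proof. by rewrite ee_decay expR_le1 oppr_le0 decay_ge0. Qed.
Lemma ee01 x : 0 <= ee p x <= 1. Proof. by rewrite ee_ge0 ee_le1. Qed.

Lemma expRN_le_inv (t : R) : 0 < t -> expR (- t) <= t^-1.
Proof.
move=> t0; rewrite expRN lef_pV2 ?posrE ?expR_gt0//.
by have := expR_ge1Dx t; lra.
Qed.

(** The crude bound [e^(-t) <= 1/t] replaces the doubly exponential decay towards the left by a
    geometric one, so that every error term becomes a geometric series. *)
Lemma ee_le x : ee p x <= y (- x).
Proof. by rewrite ee_decay decayN expRN_le_inv// decay_gt0. Qed.

Lemma ee_comp_le x : 1 - ee p x <= y x.
Proof. by rewrite ee_decay; have := expR_ge1Dx (- y x); lra. Qed.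

(** With [t = y x], [1 - e^(-t) >= t / (1 + t) = 1 / (1 + 1/t) >= e^(-1/t)], both inequalities
    coming from [1 + u <= e^u]. It serves to bound the infinite product in [Psi] away from 0. *)
Lemma ee_comp_ge x : expR (- y (- x)) <= 1 - ee p x.
Proof.
rewrite ee_decay decayN; set t := y x.
have t0 : 0 < t by exact: decay_gt0.
have et : 1 + t <= expR t := expR_ge1Dx t.
rewrite (expRN t) (expRN t^-1).
have ge : t^-1 <= expR t^-1 - 1 by have := expR_ge1Dx t^-1; lra.
have e0 : 0 < expR t by exact: expR_gt0.
have ie0 : 0 < expR t^-1 by exact: expR_gt0.
rewrite -[leLHS]div1r ler_pdivrMr//.
have h1 : (expR t)^-1 <= (1 + t)^-1 by rewrite lef_pV2 ?posrE//; lra.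
have h2 : 0 <= 1 - (expR t)^-1 by rewrite subr_ge0 invf_le1//; lra.
have h3 : 1 - (1 + t)^-1 = t / (1 + t) by field; lra.
have h4 : t / (1 + t) * (1 + t^-1) = 1 by field; lra.
have h5 : 0 < t^-1 by rewrite invr_gt0.
nra.
Qed.

Lemma alphaE : alpha p = Q / (1 - Q). Proof. by []. Qed.

Lemma alpha_gt0 : 0 < alpha p.
Proof. by rewrite alphaE divr_gt0 ?qq_gt0// subr_gt0 qq_lt1. Qed.

(* Both sides are the sum of [decay (x + j)] over j >= 0. *)
Lemma alpha_decay x : alpha p * y (x - 1) = y x / (1 - Q).
Proof.
have : x = (x - 1) + 1 by ring.
move=> {2}->; rewrite decayS alphaE; ring.
Qed.

Lemma sum_decay_le x (a b : nat) :
  \sum_(a <= j < b) y (x + j%:R) <= y (x + a%:R) / (1 - Q).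
Proof.
under eq_bigr do rewrite decayDn.
by rewrite decayDn sum_geometric_le// ?decay_ge0 ?qq_bounds.
Qed.

(* [pbe x N k] is the probability of exactly [k] ones among independent
   Bernoulli variables at the positions x, x + 1, ..., x + N - 1, the one at
   position z vanishing with probability [ee p z]. *)
Fixpoint pbe (x : R) (N k : nat) : R :=
  if N is N'.+1 then
    ee p x * pbe (x + 1) N' k +
    (1 - ee p x) * (if k is k'.+1 then pbe (x + 1) N' k' else 0)
  else (k == 0%N)%:R.

Lemma pbe01 x N k : 0 <= pbe x N k <= 1.
Proof.
elim: N x k => [|N IH] x k /=; first by case: (k == _); rewrite ler01 lexx.
have e := ee01 x; have h1 := IH (x + 1) k.
case: k h1 => [|k] h1; first by nra.
have h2 := IH (x + 1) k; nra.
Qed.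

(** The added last position matters only if it carries a one, which has probability at most
    [y (x + N)]. As [pbe] recurses at the left end, the right end is reached by induction. *)
Lemma pbe_recr_dist x N k : `|pbe x N.+1 k - pbe x N k| <= y (x + N%:R).
Proof.
elim: N x k => [|N IH] x k.
  rewrite addr0 /=; have e := ee01 x; have ec := ee_comp_le x.
  by case: k => [|[|k]] /=; rewrite ler_norml; lra.
have e := ee01 x; have h1 := IH (x + 1) k.
have e1 : x + 1 + N%:R = x + N.+1%:R by rewrite -natr1; ring.
rewrite -[pbe x N.+2 k]/(ee p x * pbe (x + 1) N.+1 k +
  (1 - ee p x) * (if k is k'.+1 then pbe (x + 1) N.+1 k' else 0)).
rewrite -[pbe x N.+1 k]/(ee p x * pbe (x + 1) N k +
  (1 - ee p x) * (if k is k'.+1 then pbe (x + 1) N k' else 0)).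
rewrite -e1; move: h1; case: k => [|k] h1.
  by move: h1; rewrite !ler_norml; nra.
have h2 := IH (x + 1) k; move: h1 h2; rewrite !ler_norml => h1 h2.
by apply/andP; split; nra.
Qed.

Lemma pbe_dist x N K k :
  `|pbe x (N + K)%N k - pbe x N k| <= y (x + N%:R) / (1 - Q).
Proof.
apply: le_trans (sum_decay_le x N (N + K)).
elim: K => [|K IH]; first by rewrite addn0 subrr normr0 big_geq.
rewrite addnS big_nat_recr ?leq_addr//=.
have -> : pbe x (N + K).+1 k - pbe x N k = 
  (pbe x (N + K)%N k - pbe x N k) + (pbe x (N + K).+1 k - pbe x (N + K)%N k).
  by ring.
by rewrite (le_trans (ler_normD _ _))// lerD// pbe_recr_dist.
Qed.

(** Fewer ones than positions force a zero among the first [k + 1] positions; [t] is the index of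
    the first zero. *)
Lemma pbe_first_zero x N k : (k < N)%N ->
  pbe x N k = \sum_(t < k.+1) (\prod_(i < t) (1 - ee p (x + i%:R))) *
    ee p (x + t%:R) * pbe (x + t%:R + 1) (N - t.+1)%N (k - t)%N.
Proof.
elim: N x k => [//|N IH] x k kN.
rewrite big_ord_recl big_ord0 mul1r addr0 subn0 subn1 /=; congr (_ + _).
case: k kN => [|k] kN; first by rewrite big_ord0 mulr0.
rewrite IH// big_distrr; apply: eq_bigr => /= t _.
rewrite !mulrA big_ord_recl /= addr0 subSS.
have e : forall j : nat, x + 1 + j%:R = x + (bump 0 j)%:R.
  by move=> j; rewrite /bump add1n -natr1; ring.
rewrite e (_ : (k.+1 - bump 0 t = k - t)%N)//.
by congr (_ * _ * _ * _); apply: eq_bigr => i _; rewrite e.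
Qed.
End analysis.

(** * Sums over increasing tuples *)

Definition increasing_tuples (v : nat) (b : int) : set (v.-tuple int) :=
  [set r : v.-tuple int | sorted <%R r /\ forall j, b <= tnth r j].

Definition increasing_tuples_below (v : nat) (b : int) (N : nat) :
    set (v.-tuple int) :=
  [set r : v.-tuple int | sorted <%R r /\ forall j, b <= tnth r j < b + N%:Z].

Arguments increasing_tuples : clear implicits.
Arguments increasing_tuples_below : clear implicits.

Section elementary_sums.
Context {R : realType} (p : R).
Hypotheses (p_gt0 : 0 < p) (p_lt1 : p < 1).

Local Notation y := (decay p).
Local Notation Q := (qq p).

Definition odds (x : R) : R := (1 - ee p x) / ee p x.

Lemma odds_ge0 x : 0 <= odds x.
Proof. by rewrite divr_ge0 ?ee_ge0// subr_ge0 ee_le1. Qed.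

(* The elementary symmetric polynomial of degree [k] in the odds at the
   positions x, ..., x + N - 1. *)
Fixpoint esym (x : R) (N k : nat) : R :=
  if N is N'.+1 then
    odds x * (if k is k'.+1 then esym (x + 1) N' k' else 0) + esym (x + 1) N' k
  else (k == 0%N)%:R.

Lemma esym_ge0 x N k : 0 <= esym x N k.
Proof.
elim: N x k => [|N IH] x k /=; first exact: ler0n.
by case: k => [|k]; rewrite ?mulr0 ?addr_ge0// mulr_ge0// odds_ge0.
Qed.

Lemma esym_homo x k : {homo (esym x)^~ k : N K / (N <= K)%N >-> N <= K}.
Proof.
move=> N K; elim: N K x k => [|N IH] [|K] x k //= NK.
  case: k => [|k]; last by rewrite addr_ge0 ?esym_ge0// mulr_ge0 ?odds_ge0 ?esym_ge0.
  clear; rewrite mulr0 add0r; elim: K (x + 1) => [|K IH] z //=.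
  by rewrite mulr0 add0r.
apply: lerD; last exact: IH.
by case: k => [|k]; rewrite ?mulr0// ler_wpM2l ?odds_ge0// IH.
Qed.

(** Once the all-zero probability is factored out, each one carries the weight [odds], because
    [ee * odds = 1 - ee]. *)
Lemma pbe_esym x N k :
  pbe p x N k = expR (- \sum_(j < N) y (x + j%:R)) * esym x N k.
Proof.
elim: N x k => [|N IH] x k; first by rewrite big_ord0 oppr0 expR0 mul1r.
rewrite big_ord_recl addr0 opprD expRD -ee_decay.
under eq_bigr do rewrite /= /bump add1n -natr1 (addrC _ 1) addrA.
have e0 : ee p x != 0 by rewrite gt_eqF// ee_gt0.
have oe : ee p x * odds x = 1 - ee p x by rewrite /odds; field.
rewrite /= IH; case: k => [|k]; first by rewrite /= !mulr0; ring.
by rewrite /= IH -oe; ring.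
Qed.

Lemma sorted_thead_le (v : nat) (r : v.+1.-tuple int) j :
  sorted <%R r -> thead r <= tnth r j.
Proof.
move=> sr; rewrite (tnth_nth 0) /thead (tnth_nth 0).
have := sorted_ltn_nth lt_trans 0 sr.
case: (posnP j) => [->//|j0] /(_ 0%N j); rewrite !inE !size_tuple => h.
by rewrite ltW// h//.
Qed.

(** Induction on [N]: tuples with head [b] correspond, by consing [b], to shorter tuples with
    entries above [b], and all other tuples start at [b + 1] or later. The free factor [c] absorbs
    the odds of the head. *)
Lemma esum_increasing_tuples_below (eta : R) (v : nat) (b : int) (N : nat)
    (c : R) : 0 <= c ->
  \esum_(r in increasing_tuples_below v b N)
     (c * \prod_(j < v) odds (eta + (tnth r j)%:~R))%:E =
  (c * esym (eta + b%:~R) N v)%:E.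
Proof.
have prod0 c' w (r : w.-tuple int) : 0 <= c' ->
    (0 <= (c' * \prod_(j < w) odds (eta + (tnth r j)%:~R))%:E)%E.
  by move=> c'0; rewrite lee_fin mulr_ge0// prodr_ge0// => *; exact: odds_ge0.
elim: N v b c => [|N IH] v b c c0.
  case: v => [|v] /=.
    rewrite (_ : increasing_tuples_below 0 b 0 = [set [tuple]]).
      by rewrite esum_set1 ?prod0// big_ord0.
    apply/seteqP; split=> r /=; first by rewrite (tuple0 r).
    by move=> ->; split => // -[].
  rewrite (_ : increasing_tuples_below _ _ _ = set0) ?esum_set0 ?mulr0//.
  by apply/seteqP; split=> r //= -[_ /(_ ord0)]; lia.
case: v => [|v].
  rewrite /= mulr0 add0r -(_ : eta + (b + 1)%:~R = eta + b%:~R + 1).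
    rewrite -IH//; congr esum; apply/seteqP; split=> r /= [sr _]; split => // -[]//.
  by rewrite intrD; ring.
rewrite (esumID [set r | thead r = b]); last by move=> *; exact: prod0.
rewrite (_ : _ `&` ~` _ = increasing_tuples_below v.+1 (b + 1) N); last first.
  apply/seteqP; split=> r /=.
    move=> [[sr rb] rn]; split => // j; have := rb j.
    have := sorted_thead_le j sr; have := rb ord0.
    rewrite -/(thead r); lia.
  move=> [sr rb]; split; first by split => // j; have := rb j; lia.
  by have := rb ord0; rewrite -/(thead r); lia.
rewrite IH// (reindex_esum (increasing_tuples_below v (b + 1) N) _
  (fun r => [tuple of b :: r])); last first.
  split.
  - move=> r [sr rb] /=; split; last by rewrite theadE.
    split => /=.
      case: v r sr rb => [|v] r sr rb; first by rewrite (tuple0 r).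
      case/tupleP: r sr rb => r0 r /= -> /(_ ord0); rewrite tnth0 andbT; lia.
    move=> j; case: (unliftP ord0 j) => [i ->|->]; rewrite ?tnthS ?tnth0; last lia.
    by have := rb i; lia.
  - move=> r1 r2 _ _ /(congr1 val) /= [] /val_inj //.
  - move=> r [[sr rb] rn]; exists [tuple of behead r]; last first.
      by apply/val_inj => /=; rewrite -rn; case/tupleP: r {sr rb rn}.
    split; first by rewrite /=; case/tupleP: r sr {rb rn} => r0 r /path_sorted.
    move=> j; have := rb (lift ord0 j).
    have -> : tnth r (lift ord0 j) = tnth [tuple of behead r] j.
      by case/tupleP: r {sr rb rn} => r0 r; rewrite tnthS !(tnth_nth 0).
    have bt : b < tnth [tuple of behead r] j.
      have sz := size_tuple r; have jv := ltn_ord j.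
      have := sorted_ltn_nth lt_trans 0 sr 0%N j.+1; rewrite !inE sz => st.
      move: (st isT jv isT); rewrite -{1}rn /thead !(tnth_nth 0) /=.
      by rewrite nth_behead.
    move: (tnth _ _) bt => t; lia.
under eq_esum => r rb.
  rewrite big_ord_recl tnth0; under eq_bigr do rewrite tnthS.
  rewrite mulrA; over.
rewrite (IH _ _ _ (mulr_ge0 c0 (odds_ge0 _))) -EFinD; congr EFin.
by rewrite /= intrD mulr1z !addrA mulrDr mulrA.
Qed.

(** An [esum] is a supremum over finite subsets, and finitely many tuples have bounded entries. The
    parameter [K] lets the bound be pushed beyond any prescribed one. *)
Lemma fsets_increasing_tuples v b (X : set (v.-tuple int)) (K : nat) :
  fsets (increasing_tuples v b) X ->
  exists2 N, (K <= N)%N & fsets (increasing_tuples_below v b N) X.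
Proof.
move=> [finX XD].
pose g (r : v.-tuple int) := (\max_(j < v) (absz (tnth r j - b)).+1)%N.
exists (K + \max_(r <- finmap.enum_fset (fset_set X)) g r)%N; first exact: leq_addr.
split=> // r Xr; have [sr rb] := XD _ Xr; split => // j; rewrite rb /=.
have h1 : ((absz (tnth r j - b)).+1 <= g r)%N by exact: leq_bigmax.
have h2 : (g r <= \max_(r <- finmap.enum_fset (fset_set X)) g r)%N.
  by apply: leq_bigmax_seq => //; rewrite in_fset_set// inE.
move: h1 h2 (rb j); move: (\max_(r <- _) _)%N (g r) (tnth r j) => B C t; lia.
Qed.

(** The exponent is the sum of [y] over all positions from [eta + b] on, so [e^(-Y) * S] is the
    probability of exactly [v] ones on the whole half-line. Cutting at [N] costs at most the chance
    of a one further right. *)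
Lemma esum_increasing_tuples (eta : R) (v : nat) (b : int) :
  exists S : R, [/\ 0 <= S,
    (\esum_(r in increasing_tuples v b)
      (\prod_(j < v) odds (eta + (tnth r j)%:~R))%:E = S%:E)%E &
    forall N, `|expR (- (y (eta + b%:~R) / (1 - Q))) * S
                - pbe p (eta + b%:~R) N v|
      <= y (eta + b%:~R + N%:R) / (1 - Q)].
Proof.
set x := eta + b%:~R; set Y := y x / (1 - Q).
set a := fun r : v.-tuple int =>  (\prod_(j < v) odds (eta + (tnth r j)%:~R))%:E.
set E := esum _ _.
have below N : \esum_(r in increasing_tuples_below v b N) a r = (esym x N v)%:E.
  rewrite -[esym _ _ _]mul1r -esum_increasing_tuples_below//.
  by apply: eq_esum => r _; rewrite mul1r.
have leE N : ((esym x N v)%:E <= E)%E.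
  rewrite -below; apply: le_ereal_sup => _ [X [finX XD] <-]; exists X => //.
  by split => // r /XD[sr rb]; split => // j; have /andP[] := rb j.
have Ele K (c : R) : (forall N, (K <= N)%N -> esym x N v <= c) -> (E <= c%:E)%E.
  move=> cb; apply: ge_ereal_sup => _ [X /(@fsets_increasing_tuples _ _ _ K)[N KN XD] <-].
  rewrite (@le_trans _ _ (esym x N v)%:E)// ?lee_fin ?cb//.
  by rewrite -below; apply: esum_ge; exists X.
have Q1 : 0 < 1 - Q by rewrite subr_gt0 qq_lt1.
have sumY N : \sum_(j < N) y (x + j%:R) <= Y.
  by have := sum_decay_le p_gt0 p_lt1 x 0 N; rewrite big_mkord addr0.
have pbeY N : expR (- Y) * esym x N v <= pbe p x N v.
  by rewrite pbe_esym ler_wpM2r ?esym_ge0// ler_expR lerN2.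
have tot N K : (N <= K)%N ->
    expR (- Y) * esym x K v <= pbe p x N v + y (x + N%:R) / (1 - Q).
  move=> NK; apply: (le_trans (pbeY K)).
  have := pbe_dist p_gt0 p_lt1 x N (K - N) v; rewrite subnKC//.
  by rewrite ler_norml; lra.
(* Finite because [e^(-Y) * esym <= pbe <= 1] bounds every truncation by [e^Y]. *)
have Efin : E \is a fin_num.
  rewrite ge0_fin_numE; last by rewrite (le_trans _ (leE 0%N))// lee_fin esym_ge0.
  rewrite (@le_lt_trans _ _ (expR Y)%:E) ?ltry//.
  apply: (Ele 0%N) => N _; have := pbeY N; have := pbe01 p x N v.
  have := expRxMexpNx_1 Y; have := expR_gt0 Y; have := esym_ge0 x N v; nra.
have ES : E = (fine E)%:E by rewrite fineK.
exists (fine E); split => //.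
  by rewrite fine_ge0// (le_trans _ (leE 0%N))// lee_fin esym_ge0.
have leS N : esym x N v <= fine E by rewrite -lee_fin -ES.
move=> N; rewrite ler_norml; apply/andP; split.
  (* Lower bound: [Y] is the sum over the first [N] positions plus the tail [t]. Requiring zeros on
     the tail costs the factor [e^(-t) >= 1 - t]. *)
  set t := y (x + N%:R) / (1 - Q).
  have split_sum : Y = \sum_(j < N) y (x + j%:R) + t.
    rewrite /Y /t decayDn//; under eq_bigr do rewrite decayDn//.
    rewrite -big_distrr/=; have := subrX1 Q N.
    move=> h; apply: (mulIf (lt0r_neq0 Q1)); rewrite mulrDl !mulfVK ?gt_eqF//.
    rewrite -mulrA (mulrC _ (1 - Q)) -opprB mulNr -h; ring.
  have p01 := pbe01 p x N v.
  have e1 : 1 - t <= expR (- t) by have := expR_ge1Dx (- t); lra.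
  have t0 : 0 <= t by rewrite divr_ge0 ?decay_ge0// ltW.
  have : expR (- t) * pbe p x N v <= expR (- Y) * fine E.
    rewrite pbe_esym mulrA -expRD -opprD addrC -split_sum.
    by rewrite ler_wpM2l ?expR_ge0.
  nra.
(* Upper bound: [tot] holds for all [K >= N], hence for the supremum. *)
have : fine E <= expR Y * (pbe p x N v + y (x + N%:R) / (1 - Q)).
  rewrite -lee_fin -ES; apply: (Ele N) => K /tot.
  have := expRxMexpNx_1 Y; have := expR_gt0 Y; have := esym_ge0 x K v; nra.
move=> /(ler_wpM2l (expR_ge0 (- Y))).
by rewrite mulrA (mulrC (expR (- Y)) (expR Y)) expRxMexpNx_1 mul1r; lra.
Qed.

End elementary_sums.

(** * The limit law *)

Lemma exists_geometric_lt {R : realType} (c z e : R) : 0 <= z < 1 -> 0 < e ->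
  exists N0, forall N, (N0 <= N)%N -> c * z ^+ N < e.
Proof.
move=> /andP[z0 z1] e0.
have : (fun N => c * z ^+ N) @ \oo --> c * 0.
  by apply: cvgMr; apply: cvg_expr; rewrite ger0_norm.
rewrite mulr0 => /cvgrPdist_lt /(_ e e0) [N0 _ h]; exists N0 => N /h /=.
by rewrite sub0r normrN => /(le_lt_trans (ler_norm _)).
Qed.

Lemma le_geometric_limit {R : realType} (a b c z : R) : 0 <= z < 1 ->
  (forall N, a <= b + c * z ^+ N) -> a <= b.
Proof.
move=> z01 h; apply/ler_addgt0Pr => e e0.
have [N hN] := exists_geometric_lt c z01 e0.
by have := h N; have := hN N (leqnn N); lra.
Qed.

(** Geometric domination yields finiteness and the truncation error at once; it is applied to [f],
    to [F] and to a countable union bound. *)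
Lemma nneseries_geometric {R : realType} (g : nat -> R) (c z : R) :
  0 <= z < 1 -> (forall v, 0 <= g v <= c * z ^+ v) ->
  exists2 s, (\sum_(0 <= v <oo) (g v)%:E)%E = s%:E &
    forall m, 0 <= s - \sum_(0 <= v < m) g v <= c * z ^+ m / (1 - z).
Proof.
move=> z01 gb.
have g0 v : (0 <= (g v)%:E)%E by rewrite lee_fin; case/andP: (gb v).
have c0 : 0 <= c by have := gb 0%N; rewrite expr0 mulr1 => /andP[]; exact: le_trans.
set E := limn _.
have lo m : ((\sum_(0 <= v < m) g v)%:E <= E)%E.
  by rewrite -sumEFin; apply: nneseries_lim_ge => *; exact: g0.
have up m : (E <= (\sum_(0 <= v < m) g v + c * z ^+ m / (1 - z))%:E)%E.
  apply: lime_le; first by apply: is_cvg_nneseries => *; exact: g0.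
  exists m => // k /= mk; rewrite sumEFin lee_fin (big_cat_nat (leq0n m) mk)//= lerD2l.
  rewrite (le_trans _ (sum_geometric_le m k c0 z01))//.
  by apply: ler_sum => i _; case/andP: (gb i).
have Efin : E \is a fin_num.
  rewrite ge0_fin_numE; first by rewrite (le_lt_trans (up 0%N))// ltry.
  by rewrite (le_trans _ (lo 0%N))// big_geq.
exists (fine E); first by rewrite fineK.
move=> m; have := lo m; have := up m.
by rewrite -(fineK Efin) !lee_fin; lra.
Qed.

Section limit_law.
Context {R : realType} (p : R).
Hypotheses (p_gt0 : 0 < p) (p_lt1 : p < 1).

Local Notation y := (decay p).
Local Notation Q := (qq p).

Definition lead_prod (x : R) (m : nat) : R :=
  \prod_(1 <= i < m.+1) (1 - ee p (x - i%:R)).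

Lemma lead_prod01 x m : 0 <= lead_prod x m <= 1.
Proof.
apply/andP; split; first by apply: prodr_ge0 => i _; rewrite subr_ge0 ee_le1.
by rewrite prodr_ile1// => i _; rewrite subr_ge0 ee_le1 lerBlDr lerDl ee_ge0.
Qed.

(** The additional factors multiply the product by a number between 1 minus the sum of [y (i - x)]
    over [i > m] and 1, and that sum is at most [alpha p * y (m - x)]. *)
Lemma lead_prodD x m K :
  0 <= lead_prod x m - lead_prod x (m + K) <= alpha p * y (m%:R - x).
Proof.
have mK : (m.+1 <= (m + K).+1)%N by rewrite ltnS leq_addr.
rewrite /lead_prod (big_cat_nat (ltn0Sn m) mK)/=.
rewrite -/(lead_prod x m).
set r := \prod_(m.+1 <= i < _) _.
have r01 : 1 - alpha p * y (m%:R - x) <= r <= 1.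
  apply/andP; split; last first.
    by rewrite prodr_ile1// => i _; rewrite subr_ge0 ee_le1 lerBlDr lerDl ee_ge0.
  apply: le_trans (prod_1sub_ge _ _); last by move=> i _; rewrite ee_ge0 ee_le1.
  rewrite lerB// (_ : m%:R - x = (- x + m.+1%:R) - 1); last by rewrite -natr1; ring.
  rewrite alpha_decay//; apply: le_trans (sum_decay_le p_gt0 p_lt1 _ _ (m + K).+1).
  by apply: ler_sum => i _; rewrite (le_trans (ee_le _ _))// opprB addrC.
have h := lead_prod01 x m; have a0 := alpha_gt0 p_gt0 p_lt1.
have d0 := decay_gt0 p (m%:R - x).
have : 0 <= alpha p * y (m%:R - x) by rewrite mulr_ge0// ltW.
move: (_ * _) r01 => t; nra.
Qed.

Lemma lead_prod_ge x m : expR (- (alpha p * y (- x))) <= lead_prod x m.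
Proof.
have -> : - x = (- x + 1%:R) - 1 by ring.
rewrite alpha_decay//.
apply: (@le_trans _ _ (expR (- \sum_(1 <= i < m.+1) y (- x + i%:R)))).
  by rewrite ler_expR lerN2 sum_decay_le.
rewrite -sumrN expR_sum; apply: ler_prod => i _.
by rewrite expR_ge0 (le_trans _ (ee_comp_ge _ _))// opprB addrC.
Qed.

Definition lead (x : R) : R := limn (lead_prod x).

Lemma PsiE x : Psi p x = ee p x * lead x. Proof. by []. Qed.

(** [limn] carries information only for a convergent sequence. Factors in [0, 1] make the partial
    products nonincreasing and bounded below. *)
Lemma lead_prod_cvg x : cvgn (lead_prod x).
Proof.
apply: nonincreasing_is_cvgn.
  apply/nonincreasing_seqP => m.
  by have := lead_prodD x m 1; rewrite addn1 subr_ge0 => /andP[].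
by exists 0 => _ [m _ <-]; case/andP: (lead_prod01 x m).
Qed.

Lemma lead_dist x m : 0 <= lead_prod x m - lead x <= alpha p * y (m%:R - x).
Proof.
have h k : (m <= k)%N -> _ := fun mk => lead_prodD x m (k - m).
rewrite subr_ge0 lerBlDr addrC -lerBlDr /lead; apply/andP; split.
  apply: limr_le; first (exact: lead_prod_cvg); exists m => // k /= mk.
  by have := h k mk; rewrite subnKC//; lra.
apply: limr_ge; first (exact: lead_prod_cvg); exists m => // k /= mk.
by have := h k mk; rewrite subnKC//; lra.
Qed.

Lemma lead_ge x : expR (- (alpha p * y (- x))) <= lead x.
Proof.
rewrite /lead; apply: limr_ge; first exact: lead_prod_cvg.
by apply: nearW => m; exact: lead_prod_ge.
Qed.

Lemma lead01 x : 0 <= lead x <= 1.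
Proof.
rewrite (le_trans (expR_ge0 _) (lead_ge x)).
by have := lead_dist x 0; have := lead_prod01 x 0; lra.
Qed.

(* The probability of exactly [v] ones at the positions eta + 2 - v,
   eta + 3 - v, ... *)
Definition tail_prob (eta : R) (v : nat) : R :=
  expR (- (alpha p * y (eta + 1 - v%:R))) *
  fine (\esum_(r in increasing_tuples v (2 - v%:Z))
    (\prod_(j < v) odds p (eta + (tnth r j)%:~R))%:E).

Lemma tail_prob_spec eta v :
  [/\ (\esum_(r in increasing_tuples v (2 - v%:Z))
     (\prod_(j < v) odds p (eta + (tnth r j)%:~R))%:E)%E \is a fin_num,
   0 <= tail_prob eta v &
   forall N, `|tail_prob eta v - pbe p (eta + 2 - v%:R) N v|
     <= alpha p * y (eta + 1 - v%:R + N%:R)].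
Proof.
rewrite /tail_prob.
have [S [S0 -> dist]] := esum_increasing_tuples p_gt0 p_lt1 eta v (2 - v%:Z).
split => //=; first by rewrite mulr_ge0// expR_ge0.
move=> N; have := dist N.
have -> : eta + (2 - v%:Z)%:~R = eta + 2 - v%:R by rewrite rmorphB/= addrA.
have -> : eta + 1 - v%:R + N%:R = eta + 2 - v%:R + N%:R - 1 by ring.
have -> : eta + 1 - v%:R = eta + 2 - v%:R - 1 by ring.
by rewrite 2!(alpha_decay p_lt1).
Qed.

(** The probabilities [pbe] approximate [tail_prob] with an error geometric in [N], so their upper
    bound 1 survives the limit. *)
Lemma tail_prob01 eta v : 0 <= tail_prob eta v <= 1.
Proof.
have [_ -> dist] := tail_prob_spec eta v.
apply: (@le_geometric_limit _ _ _ (alpha p * y (eta + 1 - v%:R)) Q).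
  exact: qq_bounds.
move=> N; have := dist N; rewrite decayDn// mulrA ler_norml.
by have := pbe01 p (eta + 2 - v%:R) N v; lra.
Qed.

Lemma tail_prob0_ge eta : expR (- (alpha p * y (eta + 1))) <= tail_prob eta 0.
Proof.
have [_ _ dist] := tail_prob_spec eta 0.
apply: (@le_geometric_limit _ _ _ (alpha p * y (eta + 1)) Q).
  exact: qq_bounds.
move=> N; have := dist N; rewrite !subr0 decayDn// mulrA ler_norml.
have : expR (- (alpha p * y (eta + 1))) <= pbe p (eta + 2) N 0; last by lra.
rewrite pbe_esym (_ : eta + 1 = eta + 2 - 1); last by ring.
rewrite alpha_decay// -[leLHS]mulr1 ler_pM ?expR_ge0 ?ler01//.
  by have := sum_decay_le p_gt0 p_lt1 (eta + 2) 0 N; rewrite big_mkord addr0 ler_expR lerN2.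
exact: (esym_homo p (eta + 2) 0 (leq0n N)).
Qed.

Definition fterm (eta : R) (v : nat) : R :=
  ee p (eta + 1 - v%:R) * lead (eta + 1 - v%:R) * tail_prob eta v.

Lemma f_fterm eta : f p eta = (\sum_(0 <= v <oo) (fterm eta v)%:E)%E.
Proof.
apply: congr_lim; apply/funext => m; apply: eq_bigr => v _.
have [fin _ _] := tail_prob_spec eta v; move: fin.
rewrite /fterm /tail_prob (addrAC eta (- v%:R) 1) -PsiE.
set E := \esum_(r in increasing_tuples _ _) _.
rewrite -[X in (_ * X)%E = _]/E.
by move: E => E fin; rewrite -{1}(fineK fin) -EFinM mulrA.
Qed.

Lemma ee_shift_le eta v : ee p (eta + 1 - v%:R) <= y (- 1 - eta) * Q ^+ v.
Proof.
rewrite -decayDn// (le_trans (ee_le _ _))//.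
by rewrite (_ : - (eta + 1 - v%:R) = - 1 - eta + v%:R)//; ring.
Qed.

(** The factor [ee] alone is geometrically small in [v], its position moving left; the other two
    factors lie in [0, 1]. *)
Lemma fterm_bounds eta v : 0 <= fterm eta v <= y (- 1 - eta) * Q ^+ v.
Proof.
have l01 := lead01 (eta + 1 - v%:R); have t01 := tail_prob01 eta v.
have e0 := ee_ge0 p (eta + 1 - v%:R).
have ey := ee_shift_le eta v.
rewrite /fterm; move: (ee _ _) (lead _) (tail_prob _ _) l01 t01 e0 ey.
move=> e l t l01 t01 e0 eY; have el : 0 <= e * l <= e by nra.
by move: (e * l) el => u u01; nra.
Qed.

Definition f_real (eta : R) : R := fine (f p eta).

Lemma f_real_spec eta : f p eta = (f_real eta)%:E /\ forall m,
  0 <= f_real eta - \sum_(0 <= v < m) fterm eta v <= y (- 1 - eta) * Q ^+ m / (1 - Q).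
Proof.
have [s fE dist] := nneseries_geometric (qq_bounds p_gt0 p_lt1) (fterm_bounds eta).
by rewrite /f_real f_fterm fE.
Qed.

Lemma f_real_bounds eta : 0 <= f_real eta <= y (- 1 - eta) / (1 - Q).
Proof.
by have [_ /(_ 0%N)] := f_real_spec eta; rewrite big_geq// subr0 expr0 mulr1.
Qed.

(** The summand [v = 0] suffices: the lower bound of each of its three factors is taken at the worse
    endpoint of [-C, C]. *)
Lemma f_real_lower eta C : `|eta| <= C ->
  ee p (1 - C) * expR (- (alpha p * y (- (C + 1)))) *
    expR (- (alpha p * y (1 - C))) <= f_real eta.
Proof.
rewrite ler_norml => /andP[Ce eC].
have [_ /(_ 1%N)] := f_real_spec eta; rewrite big_nat1 subr_ge0 => /andP[+ _].
apply: le_trans; rewrite /fterm subr0.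
have a0 := ltW (alpha_gt0 p_gt0 p_lt1).
have d1 : y (eta + 1) <= y (1 - C) by apply: decay_le => //; lra.
have d2 : y (- (eta + 1)) <= y (- (C + 1)) by apply: decay_le => //; lra.
rewrite ler_pM ?(mulr_ge0 (ee_ge0 _ _)) ?expR_ge0// ?ler_pM ?expR_ge0 ?ee_ge0//.
- by rewrite !ee_decay ler_expR lerN2.
- by rewrite (le_trans _ (lead_ge _))// ler_expR lerN2 ler_wpM2l.
- by rewrite (le_trans _ (tail_prob0_ge _))// ler_expR lerN2 ler_wpM2l.
Qed.

(* The window is decomposed along its first zero, at position 1 - v, which
   corresponds to the v-th summand of [f]. *)
Lemma f_real_window eta M : (0 < M)%N ->
  `|f_real eta - pbe p (eta - M%:R) (2 * M).+1 M.+1|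
    <= y (- 1 - eta) / (1 - Q) *
       (alpha p * (y (M%:R - eta) + y (M%:R + eta)) + Q ^+ M.+2).
Proof.
move=> M0; have [_ /(_ M.+2)] := f_real_spec eta.
set c := y (- 1 - eta); set d := alpha p * _.
suff : `|\sum_(0 <= v < M.+2) fterm eta v - pbe p (eta - M%:R) (2 * M).+1 M.+1|
    <= c / (1 - Q) * d.
  have -> : c / (1 - Q) * (d + Q ^+ M.+2) =
    c / (1 - Q) * d + c * Q ^+ M.+2 / (1 - Q) by ring.
  move: (c / _ * d) (c * _ / _) (bigop _ _ _) => a b S.
  by rewrite !ler_norml; lra.
(* Here [M > 0] is what makes [M + 1] ones fewer than [2 M + 1] positions. *)
rewrite pbe_first_zero; last by lia.
(* The reversal matches the summand [v] with a first zero at window index [M + 1 - v]. *)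
rewrite (reindex_inj rev_ord_inj) big_mkord -sumrB.
apply: (le_trans (ler_norm_sum _ _ _)).
have d0 : 0 <= d.
  by rewrite mulr_ge0 ?addr_ge0 ?decay_ge0// ltW// alpha_gt0.
apply: (@le_trans _ _ (\sum_(v < M.+2) (c * Q ^+ v) * d)).
  apply: ler_sum => v _; have vM : (v < M.+2)%N by [].
  rewrite !subSS /=.
  have e1 : eta - M%:R + (M.+1 - v)%:R = eta + 1 - v%:R.
    by rewrite natrB// -natr1; ring.
  have -> : eta - M%:R + (M.+1 - v)%:R + 1 = eta + 2 - v%:R by rewrite e1; ring.
  rewrite e1 (_ : (M.+1 - (M.+1 - v) = v)%N); last lia.
  have -> : \prod_(i < (M.+1 - v)%N) (1 - ee p (eta - M%:R + i%:R)) =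
      lead_prod (eta + 1 - v%:R) (M.+1 - v).
    rewrite /lead_prod big_add1 /= big_mkord (reindex_inj rev_ord_inj) /=.
    apply: eq_bigr => i _; congr (1 - ee p _).
    by rewrite -e1 natrB; [ring|have := ltn_ord i; lia].
  have [_ t0 /(_ ((2 * M) - (M.+1 - v))%N)] := tail_prob_spec eta v.
  have -> : eta + 1 - v%:R + ((2 * M) - (M.+1 - v))%:R = M%:R + eta.
    rewrite -e1 -addrA -natrD (_ : (_ + _ = 2 * M)%N); last lia.
    by rewrite natrM; ring.
  have := lead_dist (eta + 1 - v%:R) (M.+1 - v).
  have -> : (M.+1 - v)%:R - (eta + 1 - v%:R) = M%:R - eta by rewrite -e1; ring.
  rewrite /fterm /d; have := ee_shift_le eta v; have := ee_ge0 p (eta + 1 - v%:R).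
  have := lead01 (eta + 1 - v%:R); have := pbe01 p (eta + 2 - v%:R) (2 * M - (M.+1 - v)) v.
  have := decay_ge0 p (M%:R - eta); have := decay_ge0 p (M%:R + eta).
  rewrite -/c; move: (lead _) (lead_prod _ _) (tail_prob _ _) (pbe _ _ _ _) (ee _ _).
  move: (y _) (y _) (c * _) (alpha p) => y1 y2 cq a l Pm t B e.
  move=> y20 y10 B01 l01 e0 ecq lP; rewrite !ler_norml => tB.
  rewrite mulrDr; move: (a * y1) (a * y2) lP tB => u w lP tB.
  (* Both replacements, [tail_prob] by [pbe] and [lead] by the finite product, keep [e] as a common
     factor; its geometric decay in [v] makes the errors summable. *)
  have -> : e * l * t - Pm * e * B = e * (l * (t - B) - (Pm - l) * B) by ring.
  have : - (u + w) <= l * (t - B) - (Pm - l) * B <= u + w.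
    have h1 : - w <= l * (t - B) <= w by move: (t - B) tB => r tB; nra.
    have h2 : 0 <= (Pm - l) * B <= u by move: (Pm - l) lP => r lP; nra.
    lra.
  have : 0 <= u + w by lra.
  by move: (u + w) (_ - _) => r X r0 Xr; apply/andP; split; nra.
rewrite -big_distrl ler_wpM2r//= -(big_mkord xpredT (fun v => c * Q ^+ v)).
rewrite (le_trans (sum_geometric_le _ _ (decay_ge0 p _) (qq_bounds p_gt0 p_lt1)))//.
by rewrite expr0 mulr1.
Qed.

Lemma F_spec eta : exists2 s, F p eta = s%:E & forall m,
  0 <= s - \sum_(0 <= i < m) f_real (eta - i%:R)
    <= y (- 1 - eta) / (1 - Q) * Q ^+ m / (1 - Q).
Proof.
have g_bounds i : 0 <= f_real (eta - i%:R) <= y (- 1 - eta) / (1 - Q) * Q ^+ i.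
  rewrite mulrAC -decayDn// (_ : -1 - eta + i%:R = -1 - (eta - i%:R)); last by ring.
  exact: f_real_bounds.
have [s sE dist] := nneseries_geometric (qq_bounds p_gt0 p_lt1) g_bounds.
exists s => //; rewrite -sE; apply: congr_lim; apply/funext => m.
by apply: eq_bigr => i _; have [-> _] := f_real_spec (eta - i%:R).
Qed.

End limit_law.

(** * Independence of the past and the next letter *)

Section real_probability.
Context {d : measure_display} {T : measurableType d} {R : realType}.
Variable P : probability T R.

Definition pr (A : set T) : R := fine (P A).

Lemma prE A : measurable A -> P A = (pr A)%:E.
Proof. by move=> mA; rewrite fineK// fin_num_measure. Qed.

Lemma pr_ge0 A : 0 <= pr A.
Proof. by rewrite fine_ge0. Qed.

Lemma pr_le1 A : measurable A -> pr A <= 1.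
Proof. by move=> mA; rewrite -lee_fin -prE// probability_le1. Qed.

Lemma le_pr A B : measurable A -> measurable B -> A `<=` B -> pr A <= pr B.
Proof.
by move=> mA mB AB; rewrite -lee_fin -!prE// le_measure ?inE.
Qed.

Lemma prU A B : measurable A -> measurable B -> A `&` B = set0 ->
  pr (A `|` B) = pr A + pr B.
Proof.
move=> mA mB AB0; have mAB : measurable (A `|` B) by exact: measurableU.
by apply: EFin_inj; rewrite EFinD -!prE// measureU.
Qed.

Lemma prD A B : measurable A -> measurable B ->
  pr (A `\` B) = pr A - pr (A `&` B).
Proof.
move=> mA mB; apply: EFin_inj.
have mD : measurable (A `\` B) by exact: measurableD.
have mI : measurable (A `&` B) by exact: measurableI.
by rewrite EFinB -!prE// measureD// ltey_eq fin_num_measure.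
Qed.

Lemma pr_subU A B C : measurable A -> measurable B -> measurable C ->
  A `<=` B `|` C -> pr A <= pr B + pr C.
Proof.
move=> mA mB mC ABC; have mU : measurable (B `|` C) by exact: measurableU.
apply: (le_trans (le_pr mA mU ABC)).
rewrite (_ : B `|` C = B `|` (C `\` B)); last by rewrite setUDr setDv setD0.
have mCB : measurable (C `\` B) by exact: measurableD.
have BCB : B `&` (C `\` B) = set0 by rewrite setDE setICA setICr setI0.
by rewrite (prU mB mCB BCB) lerD2l le_pr//; exact: subDsetl.
Qed.

Lemma pr_setT : pr setT = 1.
Proof. by rewrite /pr probability_setT. Qed.

Lemma pr_set0 : pr set0 = 0.
Proof. by rewrite /pr measure0. Qed.

Lemma pr_dist A B C : measurable A -> measurable B -> measurable C ->
  A `<=` B `|` C -> B `<=` A `|` C -> `|pr A - pr B| <= pr C.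
Proof.
move=> mA mB mC /(pr_subU mA mB mC) h1 /(pr_subU mB mA mC) h2.
by rewrite ler_norml; lra.
Qed.

End real_probability.

Section independent_letters.
Context {d : measure_display} {T : measurableType d} {R : realType}.
Variables (P : probability T R) (Z : nat -> {RV P >-> nat}).

(** A pointwise form of membership in the sigma-algebra of the first [m] letters; as letters are
    natural numbers, it amounts to a countable union of cylinders. *)
Definition determined (m : nat) (D : set T) : Prop :=
  forall w w', (forall j, (j < m)%N -> Z j w = Z j w') -> D w -> D w'.

Let cylinder (a : nat -> nat) (l : nat) : set T :=
  [set w | forall j, (j < l)%N -> Z j w = a j].

Let cylinder_split a l :
  cylinder a l = \bigcup_i cylinder (fun j => if (j == l)%N then i else a j) l.+1.
Proof.
apply/seteqP; split=> w /= h.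
  exists (Z l w) => //= j; rewrite ltnS leq_eqVlt.
  by case: eqP => [->//|_ /=]; exact: h.
move=> j jl; have [i _ /(_ j)] := h.
by rewrite ltnS ltnW// => /(_ isT); rewrite ltn_eqF.
Qed.

Let cylinder_trivIset a l :
  trivIset setT (fun i => cylinder (fun j => if (j == l)%N then i else a j) l.+1).
Proof.
move=> i i' _ _ [w [/= /(_ l)]]; rewrite ltnSn eqxx => /(_ isT) <- /(_ l).
by rewrite ltnSn eqxx => /(_ isT).
Qed.

Let cylinder_measurable a l : measurable (cylinder a l).
Proof.
rewrite (_ : cylinder a l = \bigcap_(j in [set j | (j < l)%N]) (Z j @^-1` [set a j]))//.
by apply: bigcap_measurableType => j _; exact: measurable_funPTI.
Qed.

(** Induction on the number of letters not yet fixed: a cylinder splits countably by the value of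
    its next letter, and once [m] letters are fixed it lies inside [D] or is disjoint from it. *)
Lemma determined_measurable m D : determined m D -> measurable D.
Proof.
move=> detD.
suff cyl k l a : (l + k = m)%N -> measurable (cylinder a l `&` D).
  rewrite (_ : D = cylinder (fun=> 0%N) 0 `&` D); first exact: (cyl m 0%N).
  by apply/seteqP; split=> [w Dw|w []//].
elim: k l a => [|k IH] l a lk.
  have [[w0 [aw0 Dw0]]|ne] := pselect (exists w, (cylinder a l `&` D) w).
    rewrite (_ : _ `&` _ = cylinder a l)//; apply/seteqP; split=> [w []//|w aw].
    split => //; apply: detD Dw0 => j; rewrite -lk addn0 => jl.
    by rewrite (aw0 _ jl) (aw _ jl).
  rewrite (_ : _ `&` _ = set0)//; apply/seteqP; split=> // w h.
  by apply: ne; exists w.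
rewrite cylinder_split setI_bigcupl; apply: bigcupT_measurable => i.
by apply: IH; rewrite addSnnS.
Qed.

Hypothesis Zindep : mutually_independent Z.

Let cylinder_indep a l A :
  P (cylinder a l `&` Z l @^-1` A) = (P (cylinder a l) * P (Z l @^-1` A))%E.
Proof.
have cylE (B : nat -> set nat) : (forall j, (j < l)%N -> B j = [set a j]) ->
    P (cylinder a l) = (\prod_(0 <= i < l) P (Z i @^-1` B i))%E.
  move=> Ba; rewrite /index_iota subn0 -(Zindep (A := B)) ?iota_uniq//.
  congr (P _); apply/seteqP; split=> w /= h j /=.
    by rewrite mem_iota add0n => /= jl; rewrite Ba//; exact: h.
  by move=> jl; have := h j; rewrite /= mem_iota add0n Ba//; exact.
pose B j := if (j < l)%N then [set a j] else A.
rewrite (cylE B) ?/B => [|j ->//].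
rewrite (_ : P (_ `&` _) = (\prod_(0 <= i < l.+1) P (Z i @^-1` B i))%E).
  by rewrite big_nat_recr//= {2}/B ltnn.
rewrite /index_iota subn0 -(Zindep (A := B)) ?iota_uniq//.
have mem j : [set` iota 0 l.+1] j <-> (j < l.+1)%N.
  by rewrite -[X in X <-> _]/(is_true (j \in iota 0 l.+1)) mem_iota.
congr (P _); apply/seteqP; split=> w.
  move=> [h Aw] j /mem; rewrite ltnS leq_eqVlt /B.
  by case: eqP => [->|_ /= jl]; rewrite ?ltnn// jl; exact: h.
move=> h; split=> [j jl|].
  by have := h j; rewrite /B jl; apply; apply/mem/ltnW.
by have := h l; rewrite /B ltnn; apply; apply/mem.
Qed.

(** The product formula is additive over the same countable splitting, and on full cylinders it is
    mutual independence applied to singletons and [A]. *)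
Lemma determined_indep m D A : determined m D ->
  P (D `&` Z m @^-1` A) = (P D * P (Z m @^-1` A))%E.
Proof.
move=> detD; have mD := determined_measurable detD.
have mA : measurable (Z m @^-1` A) by exact: measurable_funPTI.
suff cyl k l a : (l + k = m)%N -> P (cylinder a l `&` D `&` Z m @^-1` A) =
    (P (cylinder a l `&` D) * P (Z m @^-1` A))%E.
  rewrite (_ : D = cylinder (fun=> 0%N) 0 `&` D); first exact: (cyl m 0%N).
  by apply/seteqP; split=> [w Dw|w []//].
elim: k l a => [|k IH] l a lk.
  have [[w0 [aw0 Dw0]]|ne] := pselect (exists w, (cylinder a l `&` D) w).
    rewrite (_ : cylinder a l `&` D = cylinder a l).
      by move: lk; rewrite addn0 => <-; exact: cylinder_indep.
    apply/seteqP; split=> [w []//|w aw].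
    split => //; apply: detD Dw0 => j; rewrite -lk addn0 => jl.
    by rewrite (aw0 _ jl) (aw _ jl).
  rewrite (_ : cylinder a l `&` D = set0) ?set0I ?measure0 ?mul0e//.
  by apply/seteqP; split=> // w h; apply: ne; exists w.
have tI (X : set T) : trivIset setT (fun i => cylinder
    (fun j => if (j == l)%N then i else a j) l.+1 `&` X).
  by apply: trivIset_setIr; exact: cylinder_trivIset.
rewrite cylinder_split -setIA !setI_bigcupl !measure_bigcup//; last 2 first.
- by move=> i _; apply: measurableI.
- by move=> i _; apply: measurableI => //; exact: measurableI.
rewrite [in RHS]muleC (prE _ mA) -nneseriesZl// -(prE _ mA); apply: eq_eseriesr => i _.
by rewrite muleC -IH ?addSnnS// setIA.
Qed.

Lemma pr_determined_indep m D A : determined m D ->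
  pr P (D `&` Z m @^-1` A) = pr P D * pr P (Z m @^-1` A).
Proof.
move=> detD; have mD := determined_measurable detD.
have mA : measurable (Z m @^-1` A) by exact: measurable_funPTI.
by rewrite /pr determined_indep// fineM// fin_num_measure.
Qed.

End independent_letters.

(** * Avoiding repeated letters *)

(** The upper bound comes from [(1 - s + s^2) (1 + s) = 1 + s^3 >= 1] and [1 + s <= e^s]. *)
Lemma expRN_quadratic {R : realType} (s : R) : 0 <= s ->
  1 - s <= expR (- s) <= 1 - s + s ^+ 2.
Proof.
move=> s0; apply/andP; split; first by have := expR_ge1Dx (- s); lra.
have es : 1 + s <= expR s := expR_ge1Dx s.
rewrite expRN -[leLHS]div1r ler_pdivrMr ?expR_gt0//.
have : 0 <= 1 - s + s ^+ 2 by nra.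
have : (1 - s + s ^+ 2) * (1 + s) = 1 + s ^+ 3 by ring.
have : 0 <= s ^+ 3 by rewrite exprn_ge0.
move: (expR s) (s ^+ 3) (_ + s ^+ 2) es => e c u es c0 uE u0; nra.
Qed.

Section avoidance.
Context {d : measure_display} {T : measurableType d} {R : realType}.
Variables (P : probability T R) (Z : nat -> {RV P >-> nat}) (p : R).
Hypotheses (p_gt0 : 0 < p) (p_lt1 : p < 1).
Hypothesis Zgeom : forall k, is_geometric p (Z k).
Hypothesis Zindep : mutually_independent Z.

Local Notation g := (geometric_pmf p).
Local Notation pr := (pr P).

Lemma geometric_pmf_ge0 i : 0 <= g i.
Proof. by rewrite mulr_ge0 ?exprn_ge0 ?subr_ge0// ltW. Qed.

Lemma geometric_pmf_gt0 i : 0 < g i.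
Proof. by rewrite mulr_gt0 ?exprn_gt0 ?subr_gt0. Qed.

Definition occurs (n i : nat) : set T :=
  [set w | exists k, [/\ (k.+1 < n)%N, Z k w = i & Z k.+1 w = i]].

Definition matches (S : seq nat) (k : nat) : set T :=
  [set w | Z k w = Z k.+1 w /\ Z k w \in S].

Definition avoid (S : seq nat) (n : nat) : set T :=
  [set w | forall k, (k.+1 < n)%N -> ~ matches S k w].

Lemma matches_determined S k : determined Z k.+2 (matches S k).
Proof. by move=> w w' ww' [h hS]; split; rewrite -!ww'. Qed.

Lemma avoid_determined S n : determined Z n (avoid S n).
Proof.
move=> w w' ww' h k kn /matches_determined m; apply: (h k kn); apply: m => j jk.
by rewrite ww'//; exact: leq_trans jk kn.
Qed.

Lemma occurs_determined n i : determined Z n (occurs n i).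
Proof.
move=> w w' ww' [k [kn h1 h2]]; exists k; split=> //; rewrite -ww'//.
exact: ltnW.
Qed.

Lemma determined_le m n D : (m <= n)%N -> determined Z m D -> determined Z n D.
Proof.
move=> mn h w w' ww'; apply: h => j jm; apply: ww'; exact: leq_trans jm mn.
Qed.

Lemma determined_setI m D D' : determined Z m D -> determined Z m D' ->
  determined Z m (D `&` D').
Proof. by move=> h h' w w' ww' [/(h _ _ ww') ? /(h' _ _ ww')]. Qed.

Lemma determined_preimage m A : determined Z m.+1 (Z m @^-1` A).
Proof. by move=> w w' ww'; rewrite /= ww'. Qed.

Lemma letter_measurable k A : measurable (Z k @^-1` A).
Proof. exact: measurable_funPTI. Qed.

Lemma matches_measurable S k : measurable (matches S k).
Proof. exact: determined_measurable (@matches_determined S k). Qed.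

Lemma avoid_measurable S n : measurable (avoid S n).
Proof. exact: determined_measurable (@avoid_determined S n). Qed.

Lemma occurs_measurable n i : measurable (occurs n i).
Proof. exact: determined_measurable (@occurs_determined n i). Qed.

Lemma pr_letter k i : (1 <= i)%N -> pr (Z k @^-1` [set i]) = g i.
Proof. by move=> i1; rewrite /pr [P _]Zgeom. Qed.

Lemma pr_determined_letter m D i : (1 <= i)%N -> determined Z m D ->
  pr (D `&` Z m @^-1` [set i]) = pr D * g i.
Proof. by move=> i1 /pr_determined_indep ->//; rewrite pr_letter. Qed.

(** Splitting by the value [i] of letter [m] gives disjoint events, and letter [m + 1] repeats [i]
    independently of all earlier letters, with probability [g i]. *)
Lemma pr_determined_matches m D S : uniq S -> all (leq 1) S ->
  determined Z m.+1 D ->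
  pr (D `&` matches S m) =
  \sum_(i <- S) pr (D `&` Z m @^-1` [set i]) * g i.
Proof.
move=> + + detD; have mD := determined_measurable detD.
elim: S => [_ _|i S IH /= /andP[iS uS] /andP[i1 S1]].
  rewrite big_nil (_ : _ `&` _ = set0) ?pr_set0//.
  by apply/seteqP; split=> // w [_ []].
rewrite big_cons -IH//.
have detDi : determined Z m.+1 (D `&` Z m @^-1` [set i]).
  by apply: determined_setI => //; exact: determined_preimage.
rewrite -(pr_determined_letter i1 detDi).
rewrite (_ : D `&` matches (i :: S) m =
  (D `&` Z m @^-1` [set i] `&` Z m.+1 @^-1` [set i]) `|` (D `&` matches S m)).
  rewrite prU//.
  - by apply: measurableI; [apply: measurableI|]; rewrite //; exact: letter_measurable.
  - by apply: measurableI => //; exact: matches_measurable.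
  - apply/seteqP; split=> // w [[[_ /= Zi] _] [_ [_]]].
    by rewrite Zi (negPf iS).
apply/seteqP; split=> w /=.
  move=> [Dw [ZZ]]; rewrite in_cons => /orP[/eqP Zi|ZS]; last by right.
  by left; rewrite -ZZ Zi.
move=> [[[Dw Zi] Zi']|[Dw [ZZ ZS]]]; split=> //; split.
- by rewrite Zi Zi'.
- by rewrite Zi mem_head.
- by [].
- by rewrite in_cons ZS orbT.
Qed.

Lemma avoid_small S n : (n <= 1)%N -> avoid S n = setT.
Proof.
move=> n1; apply/seteqP; split=> // w _ k kn.
by have := leq_trans kn n1.
Qed.

Lemma avoid_rec S m : avoid S m.+2 = avoid S m.+1 `\` matches S m.
Proof.
apply/seteqP; split=> w /= h.
  by split=> [k km|]; apply: h => //; rewrite ltnS ltnW.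
move=> k; rewrite ltnS leq_eqVlt => /predU1P[[->]|km]; first by case: h.
by case: h => h _; apply: h.
Qed.

Lemma avoid_sub S m : avoid S m.+1 `<=` avoid S m.
Proof. by move=> w h k km; apply: h; exact: ltnW. Qed.

Section avoidance_probability.
Variable S : seq nat.
Hypotheses (S_uniq : uniq S) (S_ge1 : all (leq 1) S).

Let s := \sum_(i <- S) g i ^+ 2.
Let t := \sum_(i <- S) g i ^+ 3.
Let a n := pr (avoid S n).

Let S1 i : i \in S -> (1 <= i)%N. Proof. by move=> /(allP S_ge1). Qed.

Lemma pr_matches m : pr (matches S m) = s.
Proof.
rewrite -[matches S m]setTI pr_determined_matches//.
rewrite /s !big_seq; apply: eq_bigr => i /S1 i1.
by rewrite setTI pr_letter// expr2.
Qed.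

Let s01 : 0 <= s <= 1.
Proof.
rewrite -(pr_matches 0) pr_ge0 pr_le1//; exact: matches_measurable.
Qed.

Let t0 : 0 <= t.
Proof. by apply: sumr_ge0 => i _; rewrite exprn_ge0// geometric_pmf_ge0. Qed.

Let a_le1 n : a n <= 1. Proof. by apply: pr_le1; exact: avoid_measurable. Qed.

Let a_small n : (n <= 1)%N -> a n = 1.
Proof. by move=> n1; rewrite /a avoid_small// pr_setT. Qed.

Let a_rec m : a m.+2 =
  a m.+1 - \sum_(i <- S) pr (avoid S m.+1 `&` Z m @^-1` [set i]) * g i.
Proof.
have avS := @avoid_determined S m.+1.
rewrite /a avoid_rec prD ?pr_determined_matches//.
  exact: avoid_measurable.
exact: matches_measurable.
Qed.

(** Dropping the constraint on the last pair leaves [avoid S m], which is independent of letter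
    [m]. *)
Let last_le m i : i \in S ->
  pr (avoid S m.+1 `&` Z m @^-1` [set i]) <= a m * g i.
Proof.
move=> iS; rewrite -(pr_determined_letter (S1 iS) (@avoid_determined S m)).
apply: le_pr.
- by apply: measurableI; [exact: avoid_measurable|exact: letter_measurable].
- by apply: measurableI; [exact: avoid_measurable|exact: letter_measurable].
- by apply: setSI; exact: avoid_sub.
Qed.

(** Avoidance can fail at the last pair only if letters [m - 1] and [m] both equal [i], which costs
    [g i ^+ 2]. *)
Let last_ge m i : i \in S ->
  a m * g i - g i ^+ 2 <= pr (avoid S m.+1 `&` Z m @^-1` [set i]).
Proof.
move=> iS; rewrite -(pr_determined_letter (S1 iS) (@avoid_determined S m)).
rewrite lerBlDr; case: m => [|m].
  by rewrite !avoid_small// lerDl sqr_ge0.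
have detZ := @determined_preimage m [set i].
rewrite expr2 -{1}(pr_letter m (S1 iS)) -(pr_determined_letter (S1 iS) detZ).
apply: pr_subU.
- by apply: measurableI; [exact: avoid_measurable|exact: letter_measurable].
- by apply: measurableI; [exact: avoid_measurable|exact: letter_measurable].
- by apply: measurableI; exact: letter_measurable.
move=> w [Aw Zi]; have [[ZZ ZS]|nm] := pselect (matches S m w).
  by right; split=> //=; rewrite ZZ.
by left; split=> //; rewrite avoid_rec; split.
Qed.

Let a_decr m : a m - s <= a m.+1 <= a m.
Proof.
case: m => [|m]; first by rewrite !a_small// lexx andbT; case/andP: s01; lra.
rewrite a_rec lerD2l lerN2 gerBl; apply/andP; split.
  rewrite /s !big_seq; apply: ler_sum => i iS; rewrite expr2.
  rewrite ler_wpM2r ?geometric_pmf_ge0// (le_trans (last_le _ iS))//.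
  by rewrite ler_piMl ?geometric_pmf_ge0.
by apply: sumr_ge0 => i _; rewrite mulr_ge0 ?pr_ge0 ?geometric_pmf_ge0.
Qed.

(** The sum in [a_rec] lies between [s * a m - t] and [s * a m]; replacing [a m] by [a m.+1] costs
    at most [s] times [s]. *)
Let a_step m :
  (1 - s) * a m.+1 - s ^+ 2 <= a m.+2 <= (1 - s) * a m.+1 + t.
Proof.
have up : \sum_(i <- S) pr (avoid S m.+1 `&` Z m @^-1` [set i]) * g i <= s * a m.
  rewrite /s mulrC big_distrr/= !big_seq; apply: ler_sum => i iS.
  rewrite (_ : a m * g i ^+ 2 = a m * g i * g i); last by ring.
  by rewrite ler_wpM2r ?geometric_pmf_ge0// last_le.
have lo : s * a m - t <=
    \sum_(i <- S) pr (avoid S m.+1 `&` Z m @^-1` [set i]) * g i.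
  rewrite /s /t mulrC big_distrr/= -sumrB !big_seq; apply: ler_sum => i iS.
  have := last_ge m iS; have := geometric_pmf_ge0 i; move: (pr _) (g i) (a m).
  by move=> x y z; nra.
rewrite a_rec; have := a_decr m; have := s01; move: (bigop _ _ _) up lo => X.
move: (a m) (a m.+1) => u v; nra.
Qed.

(** The sequence is compared with the exact recursion of [e^(-m s)]. The start [n = 1] contributes
    [s]; each step adds at most [s^2 + t] from [a_step] and [s^2] from [e^(-s)] against [1 - s],
    while the factor [1 - s] keeps earlier errors from growing. *)
Lemma avoid_approx n :
  `|a n - expR (- (n%:R * s))| <= s + n%:R * (2 * s ^+ 2 + t).
Proof.
have /andP[s0 s1] := s01.
have [e1 e2] := andP (expRN_quadratic s0).
have c0 : 0 <= 2 * s ^+ 2 + t by rewrite addr_ge0// mulr_ge0// sqr_ge0.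
have e0 m : 0 <= expR (- (m%:R * s)) <= 1.
  by rewrite expR_ge0 expR_le1 oppr_le0 mulr_ge0.
case: n => [|n]; first by rewrite mul0r oppr0 expR0 a_small// subrr normr0; lra.
elim: n => [|n IH].
  by rewrite a_small// !mul1r ler_norml; nra.
have eS : expR (- (n.+2%:R * s)) = expR (- s) * expR (- (n.+1%:R * s)).
  by rewrite -expRD; congr expR; rewrite -[n.+2%:R]natr1; ring.
rewrite eS -[n.+2%:R]natr1 mulrDl mul1r; move: IH (a_step n) (e0 n.+1) e1 e2.
set w := _ * (2 * _ + _); set F := expR (- (_ * _)); set E := expR _.
move: (a _) (a _) => v u; move: (w) (F) (E) => {w F E eS} w F E.
rewrite !ler_norml => uF uv F01 E1 E2.
have h1 : - (s + w) <= (1 - s) * (u - F) <= s + w.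
  move: (u - F) (s + w) uF => r X uF; have X0 : 0 <= X by lra.
  have p1 := mulr_ge0 s0 X0.
  have p2 : 0 <= (1 - s) * (X - r) by rewrite mulr_ge0//; lra.
  have p3 : 0 <= (1 - s) * (X + r) by rewrite mulr_ge0//; lra.
  by lra.
have h2 : 0 <= (E - (1 - s)) * F <= s ^+ 2.
  have : 0 <= E - (1 - s) <= s ^+ 2 by lra.
  move: (E - _) (s ^+ 2) F01 => r X /andP[F0 F1] /andP[r0 rX].
  by rewrite mulr_ge0//= (le_trans _ rX)// ler_piMr.
have s2 : 0 <= s ^+ 2 by exact: sqr_ge0.
have -> : v - E * F = v - (1 - s) * u + (1 - s) * (u - F) - (E - (1 - s)) * F.
  by ring.
by move: ((1 - s) * (u - F)) ((E - _) * F) h1 h2 => A B hA hB; have := t0; lra.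
Qed.

End avoidance_probability.
End avoidance.

(** * Counting letters in a window *)

Section window.
Context {d : measure_display} {T : measurableType d} {R : realType}.
Variables (P : probability T R) (Z : nat -> {RV P >-> nat}) (p : R).
Hypotheses (p_gt0 : 0 < p) (p_lt1 : p < 1).
Hypothesis Zgeom : forall k, is_geometric p (Z k).
Hypothesis Zindep : mutually_independent Z.

Local Notation g := (geometric_pmf p).
Local Notation pr := (pr P).
Local Notation y := (decay p).
Local Notation Q := (qq p).

(** The factor [p^2 / q^2] in [n2] absorbs the exponent [i - 1] of the geometric law:
    [n P_i^2 = n2 q^(2 i)]. *)
Lemma decay_istar n i : (0 < n)%N -> (1 <= i)%N ->
  y (i%:R - istar p n) = n%:R * g i ^+ 2.
Proof.
move=> n0 i1; have q0 : 0 < 1 - p by rewrite subr_gt0.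
have n20 : 0 < n2 p n by rewrite !mulr_gt0 ?invr_gt0 ?exprn_gt0 ?ltr0n.
rewrite decayD decay_nat// decayN.
have -> : y (istar p n) = (n2 p n)^-1.
  rewrite /decay /istar (_ : 2 * L p * _ = ln (n2 p n)).
    by rewrite expRN lnK.
  by have := L_gt0 p_gt0 p_lt1 => L0; field; lra.
rewrite invrK /n2 /geometric_pmf /qq -exprM -(prednK i1) mulnS exprD/= exprMn -exprM mulnC.
by move: (_ ^+ (_ * 2)) => X; field; lra.
Qed.

Lemma avoid1_occurs n i : avoid Z [:: i] n = ~` occurs Z n i.
Proof.
apply/seteqP; split=> w h.
  move=> [k [kn Zk Zk']]; apply: (h k kn).
  by split; rewrite ?Zk ?Zk'// mem_head.
move=> k kn [ZZ]; rewrite mem_seq1 => /eqP Zi; apply: h.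
by exists k; split=> //; rewrite -ZZ.
Qed.

(** Disjoint pairs of letters are independent, so every two letters shrink the avoidance probability
    by [e^(-s)]. Unlike [avoid_approx], this stays useful left of the window, where [n P_i^2] is
    unbounded. *)
Lemma pr_not_occurs_le n i : (2 <= n)%N -> (1 <= i)%N ->
  pr (~` occurs Z n i) <= 4 * y (istar p n - i%:R).
Proof.
move=> n2 i1; rewrite -avoid1_occurs -opprB decayN decay_istar//; last exact: ltnW.
set s := g i ^+ 2.
have s0 : 0 < s by rewrite exprn_gt0// geometric_pmf_gt0.
have step m : pr (avoid Z [:: i] m.+2) <= expR (- s) * pr (avoid Z [:: i] m).
  have detA := @avoid_determined _ _ _ _ Z [:: i] m.
  have mA := avoid_measurable Z [:: i] m.
  have mM := matches_measurable Z [:: i] m.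
  apply: (@le_trans _ _ (pr (avoid Z [:: i] m `\` matches Z [:: i] m))).
    apply: le_pr; [exact: avoid_measurable|exact: measurableD|].
    by rewrite avoid_rec; apply: setSD; exact: avoid_sub.
  have i1' : all (leq 1) [:: i] by rewrite /= i1.
  rewrite prD// (pr_determined_matches Zgeom Zindep (isT : uniq [:: i]) i1'
    (determined_le (leqnSn m) detA)) big_seq1 (pr_determined_letter Zgeom Zindep)//.
  have : 1 - s <= expR (- s) by have := expR_ge1Dx (- s); lra.
  have := pr_ge0 P (avoid Z [:: i] m).
  rewrite (_ : pr _ * _ * _ = pr (avoid Z [:: i] m) * s); last by rewrite /s; ring.
  by move: (pr _) (expR _) => a e; nra.
have bound k : pr (avoid Z [:: i] (n %% 2 + 2 * k)%N) <= expR (- (k%:R * s)).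
  elim: k => [|k IH].
    by rewrite mul0r oppr0 expR0 pr_le1//; exact: avoid_measurable.
  rewrite mulnS addnCA (le_trans (step _))// -natr1 mulrDl mul1r opprD addrC expRD.
  by rewrite ler_wpM2l ?expR_ge0.
have := bound (n %/ 2)%N; rewrite addnC mulnC -divn_eq => /le_trans; apply.
(* The constant 4: [n <= 4 * (n %/ 2)] for [n >= 2], so [1 / (k s) <= 4 / (n s)]. *)
set k := (n %/ 2)%N; have nk : (n <= 4 * k)%N by rewrite /k; lia.
have k0 : (0 < k)%N by lia.
have ks0 : 0 < k%:R * s by rewrite mulr_gt0// ltr0n.
have ns0 : 0 < n%:R * s by rewrite mulr_gt0// ltr0n; lia.
rewrite (le_trans (expRN_le_inv ks0))// ler_pdivlMr// mulrC ler_pdivrMr//.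
by rewrite (mulrA 4) ler_wpM2r ?(ltW s0)// -natrM ler_nat.
Qed.

Lemma pr_occurs_le n i : (0 < n)%N -> (1 <= i)%N ->
  pr (occurs Z n i) <= y (i%:R - istar p n).
Proof.
move=> n0 i1; rewrite decay_istar//.
elim: n n0 => [//|[|n] IH _].
  rewrite (_ : occurs _ _ _ = set0).
    by rewrite pr_set0 mulr_ge0 ?ler0n// sqr_ge0.
  by apply/seteqP; split=> // w [k []].
have h : pr (occurs Z n.+2 i) <= pr (occurs Z n.+1 i) + pr (matches Z [:: i] n).
  apply: pr_subU; try exact: occurs_measurable; first exact: matches_measurable.
  move=> w [k [kn Zk Zk']]; move: kn; rewrite ltnS leq_eqVlt => /predU1P[[kn]|kn].
    by right; rewrite -kn; split; rewrite ?Zk ?Zk'// mem_head.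
  by left; exists k.
rewrite (le_trans h)// -[n.+2%:R]natr1 mulrDl mul1r lerD ?IH//.
have i1' : all (leq 1) [:: i] by rewrite /= i1.
by rewrite (pr_matches Zgeom Zindep (isT : uniq [:: i]) i1') big_seq1.
Qed.

Definition cnt (n i N : nat) (w : T) : nat :=
  (\sum_(j < N) (w \in occurs Z n (i + j)))%N.

Lemma cnt_recl n i N w : cnt n i N.+1 w = ((w \in occurs Z n i) + cnt n i.+1 N w)%N.
Proof.
rewrite /cnt big_ord_recl addn0; congr (_ + _)%N.
by apply: eq_bigr => j _; rewrite lift0 addnS.
Qed.

Lemma occurs_mem_eq n i w w' : (forall j, (j < n)%N -> Z j w = Z j w') ->
  (w \in occurs Z n i) = (w' \in occurs Z n i).
Proof.
move=> ww'; apply/idP/idP; rewrite !inE; apply: occurs_determined => //.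
by move=> j jn; rewrite ww'.
Qed.

(** [V] accumulates the letters already declared absent; this makes the inclusion-exclusion a
    recursion whose leaves are pure avoidance events. *)
Definition window_event (n i N m : nat) (V : seq nat) : set T :=
  [set w | cnt n i N w = m] `&` avoid Z V n.

Lemma window_event_measurable n i N m V : measurable (window_event n i N m V).
Proof.
apply: (@determined_measurable _ _ _ _ Z n); apply: determined_setI.
  move=> w w' ww' /= <-; apply: eq_bigr => j _.
  by rewrite (occurs_mem_eq _ ww').
exact: avoid_determined.
Qed.

Lemma avoid_cons i V n : avoid Z (i :: V) n = avoid Z V n `\` occurs Z n i.
Proof.
apply/seteqP; split=> w.
  move=> h; split=> [k kn [ZZ ZV]|[k [kn Zk Zk']]]; apply: (h k kn); split=> //.
  - by rewrite in_cons ZV orbT.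
  - by rewrite Zk Zk'.
  - by rewrite Zk mem_head.
move=> [h ho] k kn [ZZ]; rewrite in_cons => /orP[/eqP Zi|ZV].
  by apply: ho; exists k; split=> //; rewrite -ZZ.
exact: h k kn (conj ZZ ZV).
Qed.

Lemma window_event_rec0 n i N V :
  window_event n i N.+1 0 V = window_event n i.+1 N 0 (i :: V).
Proof.
rewrite /window_event avoid_cons; apply/seteqP; split=> w /=; rewrite cnt_recl.
  case=> + Vw; case: (boolP (w \in occurs Z n i)) => //; rewrite notin_setE.
  by rewrite add0n.
by move=> [c [Vw no]]; split=> //; rewrite c memNset.
Qed.

(** If letter [i] is absent it moves into [V]; its presence is expressed as a difference of two
    events in which [i] is unconstrained or absent. *)
Lemma window_event_recS n i N m V :
  window_event n i N.+1 m.+1 V = window_event n i.+1 N m.+1 (i :: V) `|`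
    (window_event n i.+1 N m V `\` window_event n i.+1 N m (i :: V)).
Proof.
rewrite /window_event avoid_cons; apply/seteqP; split=> w /=; rewrite cnt_recl.
  case=> + Vw; case: (boolP (w \in occurs Z n i)) => ow.
    rewrite add1n => -[cm]; right; split => // -[_ [_]]; apply.
    by rewrite inE in ow.
  by rewrite add0n => cm; left; do ! split=> //; move: ow; rewrite notin_setE.
case; first by move=> [c [Vw no]]; split=> //; rewrite c memNset.
move=> [[cm Vw] h]; split=> //; rewrite mem_set ?cm//.
by apply: contrapT => ow; apply: h.
Qed.

(** One step of the recursion involves three window events of length [N], each with error
    [3 ^+ N * B], whence the power of 3. The bound [K] covers every list [V] reached at a leaf. *)
Lemma pr_window_event (n K : nat) (lo : nat) (B : R) : (0 < n)%N ->
  (forall V, uniq V -> all (leq lo) V -> (size V <= K)%N ->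
     `|pr (avoid Z V n) - expR (- (n%:R * \sum_(i <- V) g i ^+ 2))| <= B) ->
  forall N i m V, (1 <= lo <= i)%N -> uniq V ->
    all (fun j => (lo <= j < i)%N) V -> (size V + N <= K)%N ->
  `|pr (window_event n i N m V) -
    pbe p (i%:R - istar p n) N m * expR (- (n%:R * \sum_(i <- V) g i ^+ 2))|
  <= 3 ^+ N * B.
Proof.
move=> n0 HB; have B0 : 0 <= B by rewrite (le_trans _ (HB [::] _ _ _)).
elim=> [|N IH] i m V loi uV Vi VK.
  have cnt0 w : cnt n i 0 w = 0%N by rewrite /cnt big_ord0.
  rewrite expr0 mul1r /=; case: m => [|m].
    rewrite mul1r (_ : window_event _ _ _ _ _ = avoid Z V n); last first.
      by apply/seteqP; split=> w; [case|move=> Vw; split => //=].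
    apply: HB => //; last by rewrite addn0 in VK.
    by apply: sub_all Vi => j /andP[].
  rewrite mul0r subr0 (_ : window_event _ _ _ _ _ = set0) ?pr_set0 ?normr0//.
  by apply/seteqP; split=> // w []; rewrite /= cnt0.
have uiV : uniq (i :: V).
  by rewrite /= uV andbT; apply/negP => /(allP Vi); rewrite ltnn andbF.
have iV : all (fun j => (lo <= j < i.+1)%N) (i :: V).
  rewrite /= ltnSn andbT; case/andP: loi => _ -> /=.
  by apply: sub_all Vi => j /andP[-> /ltnW].
have Vi' : all (fun j => (lo <= j < i.+1)%N) V by case/andP: iV.
have loi' : (1 <= lo <= i.+1)%N by case/andP: loi => -> /= /leqW.
have iVK : (size (i :: V) + N <= K)%N by rewrite /= addSnnS.
have VK' : (size V + N <= K)%N by rewrite (leq_trans _ VK)// addnS.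
have i1 : (1 <= i)%N by case/andP: loi; exact: leq_trans.
have IH1 m' := IH i.+1 m' (i :: V) loi' uiV iV iVK.
have IH2 m' := IH i.+1 m' V loi' uV Vi' VK'.
have := IH1 m; move: IH1 IH2.
rewrite big_cons mulrDr opprD expRD -decay_istar// -ee_decay.
have -> : i.+1%:R - istar p n = i%:R - istar p n + 1 by rewrite -natr1; ring.
set x := i%:R - istar p n; set E := expR _ => IH1 IH2 IH1m.
have B0' : 0 <= 3 ^+ N * B by rewrite mulr_ge0// exprn_ge0.
rewrite exprS -mulrA [pbe p x N.+1 m]/=; case: m IH1m => [|m] IH1m.
  rewrite window_event_rec0 mulr0 addr0 (mulrC (ee _ _)) -mulrA.
  by rewrite (le_trans IH1m)//; lra.
rewrite window_event_recS prU; first last.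
- apply/seteqP; split=> // w [[/= c _] [[/= c' _] _]].
  by move: c; rewrite c' => /n_Sn.
- by apply: measurableD; exact: window_event_measurable.
- exact: window_event_measurable.
rewrite prD; [|exact: window_event_measurable|exact: window_event_measurable].
rewrite (_ : window_event n i.+1 N m V `&` _ = window_event n i.+1 N m (i :: V)); last first.
  by apply/setIidPr => w [cw]; rewrite avoid_cons => -[Vw _].
have := IH1 m; have := IH2 m; move: IH1m.
move: (pr _) (pr _) (pr _) (3 ^+ N * B) B0' => a b c B' B'0.
move: (ee _ _) (pbe _ _ _ m.+1) (pbe _ _ _ m) => e u v.
by rewrite !ler_norml; lra.
Qed.

End window.

(** * The law of X_1 compared with the window count *)

Section X1_law.
Context {d : measure_display} {T : measurableType d} {R : realType}.
Variables (P : probability T R) (Z : nat -> {RV P >-> nat}) (p : R).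
Hypotheses (p_gt0 : 0 < p) (p_lt1 : p < 1).
Hypothesis Zgeom : forall k, is_geometric p (Z k).
Hypothesis Zindep : mutually_independent Z.

Local Notation g := (geometric_pmf p).
Local Notation pr := (pr P).
Local Notation y := (decay p).
Local Notation Q := (qq p).

Lemma XiiE n i w : Xii Z n i w = (w \in occurs Z n i)%:R.
Proof. by rewrite /Xii indicE. Qed.

Lemma X1_cnt n N w : (forall i, (N < i)%N -> ~ occurs Z n i w) ->
  X1 Z n w = (cnt Z n 1 N w)%:R%:E.
Proof.
move=> hN; apply: lim_near_cst => //; exists N.+1 => // m /= Nm.
rewrite sumEFin (big_cat_nat (ltn0Sn N) Nm)/= [X in _ + X]big1_seq ?addr0.
  by rewrite big_add1 /= big_mkord /cnt natr_sum; congr EFin.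
move=> i /= /[!mem_index_iota] /andP[Ni _].
by rewrite XiiE memNset//; exact: hN.
Qed.

Lemma occurs_bounded n w : exists N, forall i, (N < i)%N -> ~ occurs Z n i w.
Proof.
(* The sum of the letters serves as a crude upper bound for the largest one. *)
exists (\sum_(k < n) Z k w)%N => i + [k [kn Zk _]]; apply/negP; rewrite -leqNgt.
by rewrite -Zk (bigD1 (Ordinal (ltnW kn)))//= leq_addr.
Qed.

Lemma X1_nat n w : exists c : nat, X1 Z n w = c%:R%:E.
Proof.
by have [N /X1_cnt hN] := occurs_bounded n w; exists (cnt Z n 1 N w).
Qed.

Lemma X1_measurable n (A : set (\bar R)) : measurable [set w | A (X1 Z n w)].
Proof.
apply: (@determined_measurable _ _ _ _ Z n) => w w' ww' /=.
rewrite (_ : X1 Z n w = X1 Z n w')//; apply: congr_lim; apply/funext => m.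
by apply: eq_bigr => i _; rewrite !XiiE (occurs_mem_eq _ ww').
Qed.

Lemma cnt_cat n i N M w :
  cnt Z n i (N + M) w = (cnt Z n i N w + cnt Z n (i + N) M w)%N.
Proof.
rewrite /cnt big_split_ord /=; congr (_ + _)%N.
by apply: eq_bigr => j _; rewrite addnA.
Qed.

Definition missing_below (n l : nat) : set T :=
  [set w | exists2 i, (1 <= i < l)%N & ~ occurs Z n i w].

Definition present_above (n h : nat) : set T :=
  [set w | exists2 i, (h <= i)%N & occurs Z n i w].

Lemma missing_below_measurable n l : measurable (missing_below n l).
Proof.
apply: (@determined_measurable _ _ _ _ Z n) => w w' ww' [i il oi].
by exists i => // /(@occurs_determined _ _ _ _ _ _ _ _ w) h; apply: oi; apply: h => j /ww'.
Qed.

Lemma present_above_measurable n h : measurable (present_above n h).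
Proof.
apply: (@determined_measurable _ _ _ _ Z n) => w w' ww' [i il oi].
by exists i => //; exact: occurs_determined oi.
Qed.

(** A union bound over [i < l]. The terms [4 * y (istar p n - i)] form a geometric series, summed by
    induction through [1 / (1 - Q) = alpha p + 1]. *)
Lemma pr_missing_below n l : (2 <= n)%N ->
  pr (missing_below n l) <= 4 * alpha p * y (istar p n - l%:R).
Proof.
move=> n2; have a0 := alpha_gt0 p_gt0 p_lt1.
have bound_ge0 x : 0 <= 4 * alpha p * y x.
  by rewrite (mulr_ge0 (mulr_ge0 (ler0n _ 4) (ltW a0)) (decay_ge0 p x)).
elim: l => [|l IH].
  rewrite (_ : missing_below n 0 = set0); last first.
    by apply/seteqP; split=> // w [i]; rewrite andbF.
  by rewrite pr_set0.
case: l IH => [|l] IH.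
  rewrite (_ : missing_below n 1 = set0); last first.
    by apply/seteqP; split=> // w [[|i]].
  by rewrite pr_set0.
have -> : istar p n - l.+2%:R = istar p n - l.+1%:R - 1.
  by rewrite -[l.+2%:R]natr1; ring.
rewrite -mulrA (alpha_decay p_lt1).
have -> : y (istar p n - l.+1%:R) / (1 - Q) =
    (alpha p + 1) * y (istar p n - l.+1%:R).
  by rewrite alphaE; have := qq_lt1 p_gt0 p_lt1; move: (y _) => Y Q1; field; lra.
have : pr (missing_below n l.+2) <=
    pr (missing_below n l.+1) + pr (~` occurs Z n l.+1).
  apply: pr_subU; try exact: missing_below_measurable.
    by apply: measurableC; exact: occurs_measurable.
  move=> w [i]; rewrite ltnS (leq_eqVlt i) => /andP[i1 /predU1P[->|il]] oi.
    by right.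
  by left; exists i; rewrite ?i1.
have := pr_not_occurs_le p_gt0 p_lt1 Zgeom Zindep n2 (ltn0Sn l).
by move: IH; move: (pr _) (pr _) (pr _) (y _) => u v w Y; lra.
Qed.

Lemma pr_present_above n h : (0 < n)%N -> (1 <= h)%N ->
  pr (present_above n h) <= y (h%:R - istar p n) / (1 - Q).
Proof.
move=> n0 h1; set c := y _.
have [|s sE /(_ 0%N)] := @nneseries_geometric R
    (fun k => pr (occurs Z n (h + k))) c Q (qq_bounds p_gt0 p_lt1).
  move=> k; rewrite pr_ge0/= (le_trans (pr_occurs_le p_gt0 p_lt1 Zgeom Zindep n0 _))//.
    by rewrite (leq_trans h1)// leq_addr.
  by rewrite /c -decayDn// natrD addrAC.
rewrite big_geq// subr0 expr0 mulr1 => /andP[_]; apply: le_trans.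
rewrite -lee_fin -sE -prE; last exact: present_above_measurable.
rewrite (_ : (\sum_(0 <= v <oo) _)%E = (\sum_(0 <= k <oo) P (occurs Z n (h + k)))%E).
  apply: measure_sigma_subadditive.
  - by move=> k; exact: occurs_measurable.
  - exact: present_above_measurable.
  - by move=> w [i hi oi]; exists (i - h)%N => //; rewrite subnKC.
by apply: eq_eseriesr => k _; rewrite prE//; exact: occurs_measurable.
Qed.

Lemma X1_window n lo N w : (1 <= lo)%N ->
  ~ missing_below n lo w -> ~ present_above n (lo + N) w ->
  X1 Z n w = (lo.-1 + cnt Z n lo N w)%:R%:E.
Proof.
move=> lo1 nlow nhigh; rewrite (@X1_cnt n (lo.-1 + N)); last first.
  by move=> i iN oi; apply: nhigh; exists i => //; lia.
rewrite cnt_cat add1n prednK//; congr ((_ + _)%:R%:E).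
rewrite /cnt (eq_bigr (fun=> 1%N)) ?sum1_card ?card_ord// => j _.
rewrite mem_set//; apply: contrapT => oj; apply: nlow; exists (1 + j)%N => //.
by have := ltn_ord j; lia.
Qed.

(** The window consists of the letters [k - M], ..., [k + M]. The first two error terms bound the
    exceptional events on its left and right, the last one the inclusion-exclusion inside it. *)
Lemma pr_X1_window n k M (B eta : R) : eta = k%:R - istar p n -> (2 <= n)%N -> (M < k)%N ->
  (forall V, uniq V -> all (leq (k - M)) V -> (size V <= (2 * M).+1)%N ->
     `|pr (avoid Z V n) - expR (- (n%:R * \sum_(i <- V) g i ^+ 2))| <= B) ->
  `|pr [set w | X1 Z n w = k%:R%:E] - pbe p (eta - M%:R) (2 * M).+1 M.+1| <=
  4 * alpha p * y (M%:R - eta) + alpha p * y (M%:R + eta) + 3 ^+ (2 * M).+1 * B.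
Proof.
move=> etaE n2 Mk HB; set lo := (k - M)%N; have lo1 : (1 <= lo)%N by rewrite subn_gt0.
have etaM : lo%:R - istar p n = eta - M%:R by rewrite etaE /lo natrB 1?ltnW// addrAC.
have := @pr_window_event _ _ _ P Z p p_gt0 p_lt1 n _ lo B (ltnW n2) HB
  (2 * M).+1 lo M.+1 [::].
rewrite leqnn lo1 => /(_ isT isT isT (leqnn _)).
rewrite big_nil mulr0 oppr0 expR0 mulr1 etaM.
set W := window_event _ _ _ _ _ _.
have mlow := missing_below_measurable n lo.
have mhigh := present_above_measurable n (lo + (2 * M).+1).
have mX : measurable [set w | X1 Z n w = k%:R%:E].
  exact: (@X1_measurable n [set k%:R%:E]).
have mW : measurable W by exact: window_event_measurable.
have mU := measurableU _ _ mlow mhigh.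
have bad : pr (missing_below n lo `|` present_above n (lo + (2 * M).+1)) <=
    4 * alpha p * y (M%:R - eta) + alpha p * y (M%:R + eta).
  apply: (le_trans (pr_subU P mU mlow mhigh (@subset_refl _ _))); apply: lerD.
    apply: (le_trans (pr_missing_below lo n2)).
    by rewrite -opprB etaM opprB.
  apply: (le_trans (pr_present_above (ltnW n2) _)); first by rewrite (leq_trans lo1)// leq_addr.
  rewrite -(alpha_decay p_lt1) (_ : (lo + _)%:R - _ - 1 = M%:R + eta)//.
  have -> : istar p n = lo%:R - (eta - M%:R) by rewrite -etaM; ring.
  by rewrite natrD -natr1 natrM; ring.
(* The [lo - 1 = k - M - 1] letters below the window are all present, so [M + 1] ones remain for
   it. *)
have key w : ~ missing_below n lo w -> ~ present_above n (lo + (2 * M).+1) w ->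
    (X1 Z n w = k%:R%:E <-> W w).
  move=> nl nh; rewrite (X1_window lo1 nl nh); split.
    move=> [/eqP]; rewrite eqr_nat => /eqP cE; split=> [|j jn [_]//] /=.
    by move: cE; rewrite /lo; lia.
  by move=> [/= -> _]; congr (_%:R%:E); rewrite /lo; lia.
have dist : `|pr [set w | X1 Z n w = k%:R%:E] - pr W| <=
    pr (missing_below n lo `|` present_above n (lo + (2 * M).+1)).
  apply: (pr_dist P mX mW mU) => w; have [bw|/not_orP[nl nh]] := pselect
      ((missing_below n lo `|` present_above n (lo + (2 * M).+1)) w).
  - by right.
  - by move=> /(key w nl nh); left.
  - by right.
  - by move=> /(key w nl nh); left.
move: (le_trans dist bad); rewrite !ler_norml; lra.
Qed.

Lemma geometric_pmf_anti i j : (1 <= i <= j)%N -> g j <= g i.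
Proof.
move=> ij; rewrite ler_wpM2l ?(ltW p_gt0)//.
by rewrite ler_wiXn2l ?subr_ge0 ?(ltW p_lt1)// ?lerBlDr ?lerDl ?(ltW p_gt0)//; lia.
Qed.

(** Every [g i] involved is at most [delta] while [n * delta^2] is at most [Y]; hence
    [s <= K delta], [n s^2 <= K Y K delta] and [n t <= K Y delta]. *)
Lemma avoid_approx_uniform n K lo (Y delta : R) V : (1 <= lo)%N ->
  g lo <= delta -> delta <= 1 -> n%:R * delta ^+ 2 <= Y ->
  uniq V -> all (leq lo) V -> (size V <= K)%N ->
  `|pr (avoid Z V n) - expR (- (n%:R * \sum_(i <- V) g i ^+ 2))|
    <= K%:R * (1 + 2 * K%:R * Y + Y) * delta.
Proof.
move=> lo1 glo d1 nY uV loV VK.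
have V1 : all (leq 1) V by apply: sub_all loV => i; exact: leq_trans.
apply: (le_trans (avoid_approx p_gt0 p_lt1 Zgeom Zindep uV V1 n)).
have d0 : 0 <= delta by apply: le_trans glo; apply: geometric_pmf_ge0.
have sum_le e : \sum_(i <- V) g i ^+ e <= K%:R * delta ^+ e.
  apply: (@le_trans _ _ (\sum_(i <- V) delta ^+ e)).
    rewrite !big_seq; apply: ler_sum => i /(allP loV) loi.
    rewrite lerXn2r ?nnegrE ?geometric_pmf_ge0//.
    by rewrite (le_trans _ glo)// geometric_pmf_anti// lo1.
  rewrite big_const_seq count_predT iter_addr addr0 -[leLHS]mulr_natl.
  by rewrite ler_wpM2r ?exprn_ge0// ler_nat.
have s0 : 0 <= \sum_(i <- V) g i ^+ 2 by apply: sumr_ge0 => i _; exact: sqr_ge0.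
have := sum_le 2; have := sum_le 3; move: (bigop _ _ _) (bigop _ _ _) s0 => t s s0.
move: (n%:R : R) (ler0n R n) nY (K%:R : R) (ler0n R K) => N N0 nY k k0 t_le s_le.
have Y0 : 0 <= Y by apply: le_trans nY; rewrite mulr_ge0// sqr_ge0.
have dd : delta ^+ 2 <= delta by rewrite expr2; nra.
have s1 : s <= k * delta by apply: (le_trans s_le); rewrite ler_wpM2l.
have Ns : N * s <= k * Y.
  rewrite (le_trans (ler_wpM2l N0 s_le))// mulrCA ler_wpM2l//.
have Nss : N * s ^+ 2 <= k * Y * (k * delta).
  by rewrite expr2 mulrA ler_pM// mulr_ge0.
have Nt : N * t <= k * Y * delta.
  rewrite (le_trans (ler_wpM2l N0 t_le))// exprS.
  rewrite (_ : N * (k * (delta * delta ^+ 2)) = k * delta * (N * delta ^+ 2)); last by ring.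
  by rewrite (_ : k * Y * delta = k * delta * Y) ?ler_wpM2l ?mulr_ge0//; ring.
nra.
Qed.

End X1_law.

(** * Asymptotics *)

Lemma exists_nat_ge {R : realType} (x : R) :
  exists N, forall n, (N <= n)%N -> x <= n%:R.
Proof.
exists (Num.truncn `|x|).+1 => n Nn; rewrite (le_trans (ler_norm x))//.
by rewrite ltW// (lt_le_trans (truncnS_gt _))// ler_nat.
Qed.

Section asymptotics.
Context {d : measure_display} {T : measurableType d} {R : realType}.
Variables (P : probability T R) (Z : nat -> {RV P >-> nat}) (p : R).
Hypotheses (p_gt0 : 0 < p) (p_lt1 : p < 1).
Hypothesis Zgeom : forall k, is_geometric p (Z k).
Hypothesis Zindep : mutually_independent Z.

Local Notation g := (geometric_pmf p).
Local Notation pr := (pr P).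
Local Notation y := (decay p).
Local Notation Q := (qq p).

Lemma istar_unbounded (B : R) :
  exists N, forall n, (N <= n)%N -> (0 < n)%N /\ B <= istar p n.
Proof.
have L0 := L_gt0 p_gt0 p_lt1; have q0 : 0 < 1 - p by rewrite subr_gt0.
have [N hN] := exists_nat_ge (expR (B * (2 * L p)) * (1 - p) ^+ 2 / p ^+ 2).
exists (maxn 1 N) => n; rewrite geq_max => /andP[n1 /hN nB]; split=> //.
rewrite /istar ler_pdivlMr; last by rewrite mulr_gt0.
rewrite -[leLHS]expRK ler_ln ?posrE ?expR_gt0//; last first.
  by rewrite /n2 divr_gt0 ?mulr_gt0 ?exprn_gt0 ?ltr0n.
rewrite /n2 ler_pdivlMr ?exprn_gt0//.
by rewrite -ler_pdivrMr ?exprn_gt0.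
Qed.

Lemma decay_shift_le M C eta : `|eta| <= C ->
  y (M%:R + eta) <= y (- C) * Q ^+ M /\ y (M%:R - eta) <= y (- C) * Q ^+ M.
Proof.
rewrite ler_norml => /andP[Ce eC]; rewrite -decayDn//.
by split; apply: decay_le => //; lra.
Qed.

(** The order of choices matters: [M] first, making the geometric errors below [e / 2]; then [K],
    [Y] and [A], which depend on [M]; then [delta], making the window error below [e / 2]; finally
    [n]. *)
Lemma pr_X1_eq C e : 0 < e -> exists N, forall n k, (N <= n)%N ->
  `|k%:R - istar p n| <= C ->
  `|pr [set w | X1 Z n w = k%:R%:E] - f_real p (k%:R - istar p n)| <= e.
Proof.
move=> e0; have a0 := alpha_gt0 p_gt0 p_lt1.
have Q01 := qq_bounds p_gt0 p_lt1; have Q1 : 0 < 1 - Q by rewrite subr_gt0 qq_lt1.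
pose c := y (- 1 - C) / (1 - Q) * (2 * alpha p * y (- C) + 1) +
  5 * alpha p * y (- C).
have [M0 hM0] := exists_geometric_lt c Q01 (divr_gt0 e0 (ltr0n _ 2)).
pose M := M0.+1; have {hM0}hM : c * Q ^+ M < e / 2 by apply: hM0; exact: leqnSn.
pose K := (2 * M).+1; pose Y := y (- C - M%:R).
have Y0 : 0 < Y by exact: decay_gt0.
pose A := 3 ^+ K * (K%:R * (1 + 2 * K%:R * Y + Y)).
have A0 : 0 < A.
  by rewrite mulr_gt0 ?exprn_gt0// mulr_gt0 ?ltr0n// addr_gt0// ltr_wpDr// !mulr_ge0// ltW.
pose delta := Num.min 1 (e / 2 / A).
have delta0 : 0 < delta by rewrite lt_min ltr01 !divr_gt0.
(* Together with [n * g (k - M) ^+ 2 <= Y] this forces [g (k - M) <= delta]. *)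
have [N1 hN1] := exists_nat_ge (Y / delta ^+ 2).
(* This guarantees [M < k], so that the window stays within the letters from 1 on. *)
have [N2 hN2] := istar_unbounded (C + M.+1%:R).
exists (maxn 2 (maxn N1 N2)) => n k; rewrite !geq_max => /and3P[n2 nN1 nN2].
set eta := k%:R - istar p n => etaC.
have [n0 iM] := hN2 n nN2; have {nN1}nY := hN1 n nN1.
have Mk : (M < k)%N.
  rewrite -(ltr_nat R); move: etaC; rewrite /eta ler_norml -natr1 in iM *; lra.
have lo1 : (1 <= k - M)%N by rewrite subn_gt0.
have ng : n%:R * g (k - M) ^+ 2 <= Y.
  rewrite -(decay_istar p_gt0 p_lt1)//; apply: decay_le => //.
  by rewrite natrB 1?ltnW//; move: etaC; rewrite /eta ler_norml; lra.
have gd : g (k - M) <= delta.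
  rewrite -(@ler_pXn2r _ 2) ?nnegrE ?geometric_pmf_ge0 ?(ltW delta0)//.
  rewrite -(@ler_pM2l _ n%:R) ?ltr0n// (le_trans ng)//.
  by rewrite -ler_pdivrMr// exprn_gt0.
have g1 : g (k - M) <= 1 by rewrite (le_trans gd)// ge_min lexx.
have HB V uV loV VK := @avoid_approx_uniform _ _ _ P Z p p_gt0 p_lt1 Zgeom Zindep
  n K (k - M) Y _ V lo1 (lexx _) g1 ng uV loV VK.
have := pr_X1_window p_gt0 p_lt1 Zgeom Zindep (erefl eta) n2 Mk HB.
have := f_real_window p_gt0 p_lt1 eta (ltn0Sn M0); rewrite -/M -/K.
have Ag : 3 ^+ K * (K%:R * (1 + 2 * K%:R * Y + Y) * g (k - M)) <= e / 2.
  rewrite mulrA -/A -ler_pdivlMl// mulrC (le_trans gd)// ge_min lexx orbT//.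
have [y1 y2] := decay_shift_le M etaC.
have y3 : y (- 1 - eta) <= y (- 1 - C).
  by apply: decay_le => //; move: etaC; rewrite ler_norml; lra.
have QM : Q ^+ M.+2 <= Q ^+ M.
  case/andP: Q01 => Q0 /ltW Q1'.
  exact: (ler_wiXn2l Q0 Q1' (leqW (leqnSn M))).
have bound1 : y (- 1 - eta) / (1 - Q) *
    (alpha p * (y (M%:R - eta) + y (M%:R + eta)) + Q ^+ M.+2) <=
    y (- 1 - C) / (1 - Q) * (2 * alpha p * y (- C) + 1) * Q ^+ M.
  rewrite -[leRHS]mulrA ler_pM//.
  - by rewrite divr_ge0 ?decay_ge0// ltW.
  - rewrite addr_ge0//; last by rewrite exprn_ge0//; case/andP: Q01.
    by rewrite (mulr_ge0 (ltW a0))// addr_ge0 ?decay_ge0.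
  - by rewrite ler_wpM2r// invr_ge0 ltW.
  rewrite mulrDl mul1r lerD//.
  rewrite (_ : _ * Q ^+ M = alpha p * (2 * (y (- C) * Q ^+ M))); last by ring.
  by rewrite (ler_wpM2l (ltW a0))//; lra.
have bound2 : 4 * alpha p * y (M%:R - eta) + alpha p * y (M%:R + eta) <=
    5 * alpha p * y (- C) * Q ^+ M.
  have := ler_wpM2l (ltW a0) y1; have := ler_wpM2l (ltW a0) y2; lra.
move: hM; rewrite /c mulrDl; move: bound1 bound2 Ag.
move: (_ * Q ^+ M) (_ * Q ^+ M) => b1 b2.
move: (_ / _ * _) (4 * _ * _ + _) (3 ^+ K * _) (pr _) (f_real _ _) (pbe _ _ _ _).
by move=> D1 D2 D3 u v w; rewrite !ler_norml; lra.
Qed.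

Lemma pr_X1_le_split n k m : pr [set w | (X1 Z n w <= (k + m)%:R%:E)%E] =
  \sum_(0 <= i < m) pr [set w | X1 Z n w = (k + m - i)%:R%:E] +
  pr [set w | (X1 Z n w <= k%:R%:E)%E].
Proof.
elim: m k => [|m IH] k; first by rewrite addn0 big_geq// add0r.
rewrite -addSnnS IH [in RHS]big_nat_recr//= -addrA; congr (_ + _).
rewrite (_ : (k.+1 + m - m = k.+1)%N); last lia.
have leE (c c' : nat) : (c%:R%:E <= c'%:R%:E :> \bar R)%E = (c <= c')%N.
  by rewrite lee_fin ler_nat.
rewrite -prU; first last.
- by apply/seteqP; split=> // w /= [->]; rewrite leE ltnn.
- exact: (@X1_measurable _ _ _ _ Z n [set x | (x <= k%:R%:E)%E]).
- exact: (@X1_measurable _ _ _ _ Z n [set k.+1%:R%:E]).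
congr (pr _); apply/seteqP; split=> w /=; have [c ->] := X1_nat Z n w; rewrite !leE.
  by rewrite leq_eqVlt => /predU1P[->|ck]; [left|right].
by move=> [[/eqP]|ck]; [rewrite eqr_nat => /eqP ->|exact: leqW].
Qed.

(** If the letters 1, ..., [k + 1] all occurred, X_1 would exceed [k]; hence one below [k + 2] is
    missing. *)
Lemma pr_X1_le_small n k : (2 <= n)%N ->
  pr [set w | (X1 Z n w <= k%:R%:E)%E] <=
  4 * alpha p * y (istar p n - k.+2%:R).
Proof.
move=> n2.
apply: (le_trans _ (pr_missing_below p_gt0 p_lt1 Zgeom Zindep k.+2 n2)).
apply: le_pr; last first.
- move=> w /= Xk; apply: contrapT => nl; have [N hN] := occurs_bounded Z n w.
  move: Xk; rewrite (@X1_cnt _ _ _ _ Z n (k.+1 + N)) => [|i ik]; last first.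
    by apply: hN; lia.
  rewrite lee_fin ler_nat cnt_cat.
  rewrite (_ : cnt Z n 1 k.+1 w = k.+1); first by lia.
  rewrite /cnt (eq_bigr (fun=> 1%N)) ?sum1_card ?card_ord// => j _.
  rewrite mem_set//; apply: contrapT => oj; apply: nl; exists (1 + j)%N => //.
  by have := ltn_ord j; lia.
- exact: missing_below_measurable.
- exact: (@X1_measurable _ _ _ _ Z n [set x | (x <= k%:R%:E)%E]).
Qed.

Definition F_real (eta : R) : R := fine (F p eta).

(** The top [m] values are handled by [pr_X1_eq] with tolerance [e / 2 / (m + 1)] each, at centers
    within [C + m]; the rest of the distribution function and of the series [F] are both
    geometrically small in [m]. *)
Lemma pr_X1_le C e : 0 < e -> exists N, forall n k, (N <= n)%N ->
  `|k%:R - istar p n| <= C ->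
  `|pr [set w | (X1 Z n w <= k%:R%:E)%E] - F_real (k%:R - istar p n)| <= e.
Proof.
move=> e0; have a0 := alpha_gt0 p_gt0 p_lt1.
have Q01 := qq_bounds p_gt0 p_lt1; have Q1 : 0 < 1 - Q by rewrite subr_gt0 qq_lt1.
pose c := 4 * alpha p * y (- 2 - C) + y (- 1 - C) / (1 - Q) / (1 - Q).
have [m hm] := exists_geometric_lt c Q01 (divr_gt0 e0 (ltr0n _ 2)).
have {hm}cm : c * Q ^+ m < e / 2 by exact: hm.
have e20 : 0 < e / 2 / m.+1%:R by rewrite !divr_gt0// ltr0n.
have [N1 hN1] := pr_X1_eq (C + m%:R) e20.
have [N2 hN2] := istar_unbounded (C + m%:R).
exists (maxn 2 (maxn N1 N2)) => n k; rewrite !geq_max => /and3P[n2 nN1 nN2].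
set eta := k%:R - istar p n => etaC.
have [n0 iM] := hN2 n nN2.
have mk : (m <= k)%N.
  by rewrite -(ler_nat R); move: etaC; rewrite /eta ler_norml; lra.
have [s FE /(_ m)] := F_spec p_gt0 p_lt1 eta.
rewrite /F_real FE /=; rewrite -(subnK mk) pr_X1_le_split subnK//.
have := pr_X1_le_small (k - m) n2.
set S1 := \sum_(0 <= i < m) pr _; set S2 := \sum_(0 <= i < m) f_real _ _.
have S12 : `|S1 - S2| <= e / 2.
  rewrite /S1 /S2 -sumrB (le_trans (ler_norm_sum _ _ _))//.
  apply: (@le_trans _ _ (\sum_(0 <= i < m) e / 2 / m.+1%:R)).
    rewrite !big_seq; apply: ler_sum => i; rewrite mem_index_iota => im.
    have ik : (i <= k)%N by lia.
    have etai : eta - i%:R = (k - i)%:R - istar p n by rewrite natrB// addrAC.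
    rewrite etai; apply: hN1 => //; rewrite -etai.
    have : i%:R <= m%:R :> R by rewrite ler_nat; lia.
    by move: etaC (ler0n R i); rewrite !ler_norml; lra.
  rewrite sumr_const_nat subn0 -[leLHS]mulr_natr -mulrA ler_piMr ?(ltW (divr_gt0 e0 _))//.
  by rewrite mulrC ler_pdivrMr ?ltr0n// mul1r ler_nat.
have /andP[Ce eC] : - C <= eta <= C by rewrite -ler_norml.
have b1 : 4 * alpha p * y (istar p n - (k - m).+2%:R) <=
    4 * alpha p * y (- 2 - C) * Q ^+ m.
  rewrite -[leRHS]mulrA -decayDn// ler_wpM2l ?(mulr_ge0 (ler0n _ 4) (ltW a0))//.
  apply: decay_le => //; rewrite -[(k - m).+2]addn2 natrD natrB//.
  by move: eC; rewrite /eta; lra.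
have b2 : y (- 1 - eta) / (1 - Q) * Q ^+ m / (1 - Q) <=
    y (- 1 - C) / (1 - Q) / (1 - Q) * Q ^+ m.
  have z0 : 0 <= Q ^+ m / (1 - Q) / (1 - Q).
    case/andP: Q01 => Q0 _.
    exact: (divr_ge0 (divr_ge0 (exprn_ge0 m Q0) (ltW Q1)) (ltW Q1)).
  have -> : y (- 1 - eta) / (1 - Q) * Q ^+ m / (1 - Q) =
    y (- 1 - eta) * (Q ^+ m / (1 - Q) / (1 - Q)) by ring.
  have -> : y (- 1 - C) / (1 - Q) / (1 - Q) * Q ^+ m =
    y (- 1 - C) * (Q ^+ m / (1 - Q) / (1 - Q)) by ring.
  by apply: (ler_wpM2r z0); apply: decay_le => //; lra.
move: cm b1 b2 S12; rewrite /c mulrDl.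
move: (_ * Q ^+ m) (_ * Q ^+ m) => u v.
have := pr_ge0 P [set w | (X1 Z n w <= (k - m)%:R%:E)%E].
move: (pr _) (4 * _ * _) (_ * Q ^+ m / _) (S1) (S2) => a b w s1 s2.
by rewrite !ler_norml; lra.
Qed.

End asymptotics.

(** A lower bound on [v] away from 0 turns an absolute error [e * c] into a relative error [e]. *)
Lemma equiv_of_dist {R : realType} (u v : nat -> R) (c : R) : 0 < c ->
  (\forall n \near \oo, c <= v n) ->
  (forall e, 0 < e -> \forall n \near \oo, `|u n - v n| <= e) ->
  u ~_\oo v.
Proof.
move=> c0 cv uv; apply/eqaddoP => e e0.
near=> n; apply: (@le_trans _ _ (e * c)).
  by near: n; apply: uv; rewrite mulr_gt0.
rewrite ler_wpM2l ?(ltW e0)// (le_trans _ (ler_norm _))//.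
by near: n.
Unshelve. all: by end_near. Qed.

(** The integer [i] may vary with [n] as long as [eta] stays bounded, which makes the asymptotics
    locally uniform. The finiteness statement ensures that [fine] loses nothing, and dependence on
    [p] alone is visible in the arguments of [f]. *)
Theorem theorem3p5 (R : realType) (p : R) (hp0 : 0 < p) (hp1 : p < 1)
  (d : measure_display) (T : measurableType d) (P : probability T R)
  (Z : nat -> {RV P >-> nat})
  (Zgeom : forall k, is_geometric p (Z k))
  (Zindep : mutually_independent Z)
  (d' : measure_display) (T' : measurableType d') (P' : probability T' R)
  (xi : nat -> nat -> {RV P' >-> nat})
  (xipoisson : forall n i, (0 < n)%N ->
     is_poisson (n%:R * geometric_pmf p i.+1 ^+ 2) (xi n i))
  (xiindep : forall n, (0 < n)%N -> mutually_independent (xi n))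
  (hyp : forall t : R,
     (fun n => P [set w | (X1 Z n w <= t%:E)%E]
               - P' [set w | (xi_total xi n w <= t%:E)%E])%E @ \oo --> 0%E) :
  (forall eta : R, f p eta \is a fin_num /\ F p eta \is a fin_num) /\
  (forall i : nat -> int,
     let eta := fun n => (i n)%:~R - istar p n in
     (exists M : R, \forall n \near \oo, `|eta n| <= M) ->
     (fun n => fine (P [set w | X1 Z n w = (istar p n + eta n)%:E]))
       ~_\oo (fun n => fine (f p (eta n))) /\
     (fun n => fine (P [set w | (X1 Z n w <= (istar p n + eta n)%:E)%E]))
       ~_\oo (fun n => fine (F p (eta n)))).
Proof.
split=> [eta|i eta [C etaC]].
  have [-> _] := f_real_spec hp0 hp1 eta; have [s -> _] := F_spec hp0 hp1 eta.
  by [].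
have istar_eta n : istar p n + eta n = (i n)%:~R by rewrite /eta addrC subrK.
have natE : \forall n \near \oo, exists2 k : nat, eta n = k%:R - istar p n &
    istar p n + eta n = k%:R.
  (* For large [n], [istar p n >= C] makes [i n] nonnegative, hence a natural number. *)
  have [N hN] := istar_unbounded hp0 hp1 C.
  near=> n; have i0 : 0 <= i n.
    have := (hN n _).2; rewrite -(ler0z R) => /(_ _) h.
    have : `|eta n| <= C by near: n.
    have : (N <= n)%N by near: n; exists N.
    by move=> /h; rewrite /eta ler_norml; lra.
  have iE : (i n)%:~R = (absz (i n))%:R :> R by rewrite natr_absz ger0_norm.
  by exists (absz (i n)); rewrite ?istar_eta ?iE// -iE.
pose c := ee p (1 - C) * expR (- (alpha p * decay p (- (C + 1)))) *
  expR (- (alpha p * decay p (1 - C))).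
have c0 : 0 < c by rewrite !mulr_gt0 ?expR_gt0 ?ee_gt0.
split; apply: (equiv_of_dist c0).
- by near=> n; apply: (f_real_lower hp0 hp1); near: n.
- move=> e e0; have [N hN] := pr_X1_eq hp0 hp1 Zgeom Zindep C e0.
  near=> n; have [k ek ik] : exists2 k : nat, eta n = k%:R - istar p n &
    istar p n + eta n = k%:R by near: n.
  rewrite ik ek; apply: hN; first by near: n; exists N.
  by rewrite -ek; near: n.
- near=> n; have etaCn : `|eta n| <= C by near: n.
  (* The summand [i = 0] of [F] is [f] itself, so [F] inherits the lower bound [c]. *)
  have [s sE /(_ 1%N)] := F_spec hp0 hp1 (eta n).
  rewrite sE big_nat1 subr0 subr_ge0 => /andP[+ _].
  exact: le_trans (f_real_lower hp0 hp1 etaCn).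
- move=> e e0; have [N hN] := pr_X1_le hp0 hp1 Zgeom Zindep C e0.
  near=> n; have [k ek ik] : exists2 k : nat, eta n = k%:R - istar p n &
    istar p n + eta n = k%:R by near: n.
  rewrite ik ek; apply: hN; first by near: n; exists N.
  by rewrite -ek; near: n.
Unshelve. all: by end_near. Qed.
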